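(* Let $m,n\in\mathtt{N}$. Then for $t\ge s>0$, $$\rho_\nu(\mathcal{P}_m(X_{L_t}),\mathcal{P}_n(X_{L_s}))=c_\nu(n,m)\Bigl(\lambda_m\int_0^s\eta_{t-r}(\lambda_m)\,U(dr)+\eta_t(\lambda_m)\Bigr)$$ and $$\rho_\nu(\mathcal{P}_m(X_{L_t}),\mathcal{V}_n(X_{L_s}))=\kappa_\nu^{-1}(m)\,\delta_{mn}\Bigl(\lambda_m\int_0^s\eta_{t-r}(\lambda_m)\,U(dr)+\eta_t(\lambda_m)\Bigr),$$ where $U(dr)=\int_0^\infty\mathbb{P}(\mathcal{T}_t\in dr)\,dt$ is the renewal measure of the subordinator $\mathcal{T}$. Moreover, for any fixed $s>0$ (and $t\ge s$), $$c_\nu(n,m)\,\eta_t(\lambda_m)(\lambda_m\mathbb{E}[L_s]+1)\le\rho_\nu(\mathcal{P}_m(X_{L_t}),\mathcal{P}_n(X_{L_s}))\le c_\nu(n,m)\,\eta_{t-s}(\lambda_m)(\lambda_m\mathbb{E}[L_s]+1),$$ $$\kappa_\nu^{-1}(m)\delta_{mn}\,\eta_t(\lambda_m)(\lambda_m\mathbb{E}[L_s]+1)\le\rho_\nu(\mathcal{P}_m(X_{L_t}),\mathcal{V}_n(X_{L_s}))\le\kappa_\nu^{-1}(m)\delta_{mn}\,\eta_{t-s}(\lambda_m)(\lambda_m\mathbb{E}[L_s]+1).$$ Furthermore, if for a fixed $s>0$, $\limsup_{t\to\infty}\dfrac{\eta_{t-s}(\lambda_m)}{\eta_t(\lambda_m)}=C$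 for some constant $C=C(s,\lambda_m)>0$, then there exists $t_0>0$ such that, as functions of $t$, $$\rho_\nu(\mathcal{P}_m(X_{L_t}),\mathcal{P}_n(X_{L_s}))\overset{t_0}{\asymp}c_\nu(n,m)\,\eta_t(\lambda_m)(\lambda_m\mathbb{E}[L_s]+1),$$ $$\rho_\nu(\mathcal{P}_m(X_{L_t}),\mathcal{V}_n(X_{L_s}))\overset{t_0}{\asymp}\kappa_\nu^{-1}(m)\delta_{mn}\,\eta_t(\lambda_m)(\lambda_m\mathbb{E}[L_s]+1).$$ In particular, if $t\mapsto\eta_t(\lambda_m)$ is a long-tailed function, then (for fixed $s>0$) $$\rho_\nu(\mathcal{P}_m(X_{L_t}),\mathcal{P}_n(X_{L_s}))\overset{t\to\infty}{\sim}c_\nu(n,m)\,\eta_t(\lambda_m)(\lambda_m\mathbb{E}[L_s]+1),$$ $$\rho_\nu(\mathcal{P}_m(X_{L_t}),\mathcal{V}_n(X_{L_s}))\overset{t\to\infty}{\sim}\kappa_\nu^{-1}(m)\delta_{mn}\,\eta_t(\lambda_m)(\lambda_m\mathbb{E}[L_s]+1).$$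
   Context: Setting. $X=(X_t)_{t\ge0}$ is a Markov process with state space $E\subseteq\mathbb{R}$ (endowed with a sigma-algebra $\mathcal{E}$), with semigroup $P_tf(x)=\mathbb{E}_x[f(X_t)]$ for bounded Borel $f$, where $\mathbb{E}_x$ is expectation given $X_0=x$. It is assumed that $t\mapsto P_tf$ is continuous for every bounded Borel $f$ (stochastic continuity of $X$) and that $\nu$ is an invariant probability measure on $E$: $\nu P_tf=\nu f$ for all $t\ge 0$, where $\nu f=\int_E f\,d\nu$. $L^2(\nu)$ is the real Hilbert space with $\langle f,g\rangle_\nu=\int_E fg\,d\nu$ and $\|f\|_\nu=\sqrt{\langle f,f\rangle_\nu}$. $P$ extends to a strongly continuous contraction semigroup on $L^2(\nu)$, still denoted $P$; $P_t^*$ is the adjoint of $P_t$ in $L^2(\nu)$. Eigenfunctions. $\mathtt{N}\subseteq\mathbb{N}$ is a finite or countable index set, and there are distinct $\lambda_n\in\mathbb{R}_+=[0,\infty)$, $n\in\mathtt{N}$, and functions $\mathcal{P}_n,\mathcal{V}_n\in L^2(\nu)$ such that for all $n\in\mathtt{N}$, $t\ge0$: $P_t\mathcal{P}_n=e^{-\lambda_nt}\mathcal{P}_n$ and $P_t^*\mathcal{V}_n=e^{-\lambda_nt}\mathcal{V}_n$. They are normalized by $\langle\mathcal{P}_n,\mathcal{V}_n\rangle_\nu=1$ for all $n\in\mathtt{N}$. Write $\kappa_\nu(m)=\|\mathcal{P}_m\|_\nu\|\mathcal{V}_m\|_\nu$ and $c_\nu(n,m)=\dfrac{\langle \mathcal{P}_n,\mathcal{P}_m\rangle_\nu}{\|\mathcal{P}_n\|_\nu\|\mathcal{P}_m\|_\nu}$.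 Inverse subordinator. $\mathcal{T}=(\mathcal{T}_t)_{t\ge0}$ is a subordinator (real-valued Lévy process started at $0$ with non-decreasing right-continuous paths), independent of $X$, with Laplace exponent $\varphi$: $\mathbb{E}[e^{-\lambda\mathcal{T}_t}]=e^{-t\varphi(\lambda)}$ for $t,\lambda\ge0$, where $\varphi(\lambda)=\varrho\lambda+\int_0^\infty(1-e^{-\lambda y})\vartheta(dy)$, $\varrho\ge0$ and $\vartheta$ is a Lévy measure concentrated on the positive half-line with $\int_0^\infty(1\wedge y)\vartheta(dy)<\infty$. Its right inverse is $L_t=\inf\{s>0:\mathcal{T}_s>t\}$; $l_t$ is the law of $L_t$, and $\eta_t(\lambda)=\int_0^\infty e^{-\lambda s}\,l_t(ds)$ its Laplace transform. It is assumed that $\mathbb{P}(L_t<\infty)=1$ for all $t\ge0$. The time-changed process is $(X_{L_t})_{t\ge0}$. Integrals $\int_0^s\cdots U(dr)$ are understood so that $\int_0^sU(dr)=\mathbb{E}[L_s]$. Correlation. For the process $\mathbf{X}=(X_{L_t})_{t\ge 0}$, $\mathbb{E}_\nu=\int_E\mathbb{E}_x[\cdot]\,\nu(dx)$ is expectation when $X_0$ has law $\nu$. For $f,g\in L^2(\nu)$, $\mathcal{C}_\nu(f(\mathbf{X}_t),g(\mathbf{X}_s))=\mathbb{E}_\nu[f(\mathbf{X}_t)g(\mathbf{X}_s)]-\mathbb{E}_\nu[f(\mathbf{X}_t)]\mathbb{E}_\nu[g(\mathbf{X}_s)]$, $std_\nu(f(\mathbf{X}_t))=\sqrt{\mathcal{C}_\nu(f(\mathbf{X}_t),f(\mathbf{X}_t))}$,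 and $\rho_\nu(f(\mathbf{X}_t),g(\mathbf{X}_s))=\dfrac{\mathcal{C}_\nu(f(\mathbf{X}_t),g(\mathbf{X}_s))}{std_\nu(f(\mathbf{X}_t))\,std_\nu(g(\mathbf{X}_s))}$ if the denominator is positive, and $0$ otherwise. $\delta_{mn}$ is the Kronecker symbol. Asymptotic notation. $f\overset{a}{\asymp}g$ means there is a constant $K>0$ with $\frac1K g(x)\le f(x)\le Kg(x)$ for all $x\ge a$. $f(x)\overset{x\to\infty}{\sim}g(x)$ means $\lim_{x\to\infty}f(x)/g(x)=1$. A function $f$ is long-tailed if $f(x+y)\overset{x\to\infty}{\sim}f(x)$ for every fixed $y>0$.
   Formalization: If m=n and λ_m=0, P_m and V_m are assumed to have ν-mean 0 (the formula fails for P_m=V_m=1); for c_ν(n,m)<0 the two bounds are exchanged; in ~ the ratio 0/0 is read as 1; X is assumed jointly measurable in time and ω so that X_{L_t} is well defined. *)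

(* Defs.v *)
From HB Require Import structures.
From mathcomp Require Import all_boot all_order all_algebra.
From mathcomp Require Import all_classical all_reals all_analysis.

Set Implicit Arguments.
Unset Strict Implicit.
Unset Printing Implicit Defensive.

Import Order.TTheory GRing.Theory Num.Theory.
Import numFieldNormedType.Exports.

Local Open Scope classical_set_scope.
Local Open Scope ring_scope.

(* Processes have type [R -> Omega -> S]; only times [t >= 0] are meaningful,
   the values at negative times are unconstrained. *)

Section processes.
Context (R : realType) (dO : measure_display) (Omega : measurableType dO).

(* the sigma-algebra generated by [Y u], [u] in [D] *)
Definition history (dS : measure_display) (S : measurableType dS)
    (D : set R) (Y : R -> Omega -> S) : set (set Omega) :=
  <<s [set A | exists u B, [/\ D u, measurable B & A = Y u @^-1` B]] >>.

(* Joint measurability in (t, omega), with respect to the sigma-algebra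
   generated by the process itself: this is what makes [Y] evaluated at an
   independent random time a random variable with the expected law. *)
Definition measurable_process (dS : measure_display) (S : measurableType dS)
    (Y : R -> Omega -> S) : Prop :=
  (forall t : R, 0 <= t -> measurable_fun [set: Omega] (Y t)) /\
  (forall A, measurable A ->
     <<s [set B `*` C | B in measurable & C in history `[0, +oo[ Y] >>
       ((`[0, +oo[ `*` [set: Omega]) `&` [set p : R * Omega | A (Y p.1 p.2)])).

Definition independent_processes (P : probability Omega R)
    (dS dS' : measure_display) (S : measurableType dS) (S' : measurableType dS')
    (Y : R -> Omega -> S) (Z : R -> Omega -> S') : Prop :=
  forall A B : set Omega, history `[0, +oo[ Y A -> history `[0, +oo[ Z B ->
    P (A `&` B) = (P A * P B)%E.

Definition cov (P : probability Omega R) (Y Z : Omega -> R) : R :=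
  \int[P]_w (Y w * Z w) - (\int[P]_w Y w) * (\int[P]_w Z w).

Definition std (P : probability Omega R) (Y : Omega -> R) : R :=
  Num.sqrt (cov P Y Y).

Definition corr (P : probability Omega R) (Y Z : Omega -> R) : R :=
  if 0 < std P Y * std P Z then cov P Y Z / (std P Y * std P Z) else 0.

End processes.

Section L2.
Context (R : realType) (dE : measure_display) (E : measurableType dE).
Variable nu : probability E R.

(* Elements of L^2(nu) are represented by functions in [Lfun nu 2%:E];
   equality in L^2(nu) is [ae_eq nu setT]. *)
Definition inner (f g : E -> R) : R := \int[nu]_x (f x * g x).

Definition normL2 (f : E -> R) : R := Num.sqrt (inner f f).

Definition is_adjoint (Q Qs : (E -> R) -> (E -> R)) : Prop :=
  (forall g, g \in Lfun nu 2%:E -> Qs g \in Lfun nu 2%:E) /\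
  (forall f g, f \in Lfun nu 2%:E -> g \in Lfun nu 2%:E ->
     inner (Q f) g = inner f (Qs g)).

End L2.

Section markov.
Context (R : realType) (dE dO : measure_display).
Context (E : measurableType dE) (Omega : measurableType dO).
Variables (Px : R.-pker E ~> Omega) (X : R -> Omega -> E).

Definition bounded_measurable (f : E -> R) : Prop :=
  measurable_fun [set: E] f /\ exists M, forall x, `|f x| <= M.

(* [P_t f(x) = E_x[f(X_t)]].  When [nu] is invariant and [f] is in L^2(nu),
   the integral converges for nu-almost every [x] and the same formula gives
   the extension of [P_t] to L^2(nu). *)
Definition semigroup (t : R) (f : E -> R) (x : E) : R :=
  \int[Px x]_w f (X t w).

Record markov_process : Prop := {
  markov_measurable : measurable_process X ;
  markov_initial : forall x A, measurable A -> Px x (X 0 @^-1` A) = \d_x A ;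
  markov_property : forall x (s t : R) f A, 0 <= s -> 0 <= t ->
    bounded_measurable f -> history `[0, s] X A ->
    \int[Px x]_(w in A) f (X (s + t) w) =
    \int[Px x]_(w in A) semigroup t f (X s w)
}.

Definition invariant_measure (nu : probability E R) : Prop :=
  forall (t : R) f, 0 <= t -> bounded_measurable f ->
    \int[nu]_x semigroup t f x = \int[nu]_x f x.

(* Continuity is taken in L^2(nu).  Pointwise continuity at [t = 0] would fail
   for every diffusion, e.g. with [f] the indicator of the starting point. *)
Definition continuous_semigroup (nu : probability E R) : Prop :=
  forall f (t : R), bounded_measurable f -> 0 <= t ->
    normL2 nu (semigroup u f \- semigroup t f)
      @[u --> within `[0, +oo[%classic (nbhs t)] --> (0 : R).

End markov.

Section initial_law.
Local Open Scope ereal_scope.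
Context (R : realType) (dE dO : measure_display).
Context (E : measurableType dE) (Omega : measurableType dO).
Variables (Px : R.-pker E ~> Omega) (nu : probability E R).

(* the law of the system when [X_0] has law [nu] *)
Definition Pinit (A : set Omega) : \bar R := \int[nu]_x Px x A.

Let Pinit0 : Pinit set0 = 0.
Proof. by apply: integral0_eq => x _; rewrite measure0. Qed.

Let Pinit_ge0 A : 0 <= Pinit A.
Proof. by apply: integral_ge0 => x _; exact: measure_ge0. Qed.

Let Pinit_sigma_additive : semi_sigma_additive Pinit.
Proof.
move=> F mF tF mUF; rewrite /Pinit.
rewrite [X in _ --> X](_ : _ =
    \int[nu]_x \sum_(0 <= n <oo) Px x (F n)); last first.
  by apply: eq_integral => x _; rewrite measure_semi_bigcup.
rewrite integral_nneseries//; last first.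
  by move=> n; exact: measurable_kernel.
by apply: is_cvg_nneseries => n _ _; exact: integral_ge0.
Qed.

HB.instance Definition _ := isMeasure.Build _ _ _ Pinit
  Pinit0 Pinit_ge0 Pinit_sigma_additive.

Let Pinit_setT : Pinit setT = 1.
Proof.
rewrite /Pinit (eq_integral (cst 1)); last by move=> x _; rewrite prob_kernel.
by rewrite integral_cst//=; rewrite mul1e; exact: probability_setT.
Qed.

HB.instance Definition _ := @Measure_isProbability.Build _ _ _
  Pinit Pinit_setT.

End initial_law.

Section subordinators.
Context (R : realType) (dO : measure_display) (Omega : measurableType dO).
Implicit Types (P : probability Omega R) (T : R -> Omega -> R).

Definition levy_measure (theta : {measure set R -> \bar R}) : Prop :=
  theta `]-oo, 0]%classic = 0%E /\
  (\int[theta]_(y in `]0%R, +oo[) (Num.min 1 y)%:E < +oo)%E.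

Definition levy_khintchine (drift : R) (theta : {measure set R -> \bar R})
    (lambda : R) : R :=
  drift * lambda + \int[theta]_(y in `]0, +oo[) (1 - expR (- lambda * y)).

Record subordinator P T : Prop := {
  sub_measurable : forall t : R, 0 <= t -> measurable_fun [set: Omega] (T t) ;
  sub_start : forall w, T 0 w = 0 ;
  sub_nondecreasing : forall w (s t : R), 0 <= s -> s <= t -> T s w <= T t w ;
  sub_right_continuous : forall w (t : R), 0 <= t ->
    T u w @[u --> t^'+] --> T t w ;
  sub_independent_increments : forall (s h : R) A (B : set R), 0 <= s -> 0 <= h ->
    history `[0, s] T A -> measurable B ->
    P (A `&` (T (s + h) \- T s) @^-1` B) =
      (P A * P ((T (s + h)%R \- T s)%R @^-1` B))%E ;
  sub_stationary_increments : forall (s h : R) (B : set R),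
    0 <= s -> 0 <= h -> measurable B ->
    P ((T (s + h) \- T s) @^-1` B) = P (T h @^-1` B)
}.

Definition has_laplace_exponent P T (phi : R -> R) : Prop :=
  forall t lambda : R, 0 <= t -> 0 <= lambda ->
    \int[P]_w expR (- lambda * T t w) = expR (- t * phi lambda).

Definition inverse_subordinator T (t : R) (w : Omega) : \bar R :=
  ereal_inf [set s%:E | s in [set s | 0 < s /\ t < T s w]].

Definition inverse_law P T (t : R) : set R -> \bar R :=
  pushforward P (fun w => fine (inverse_subordinator T t w)).

Definition inverse_laplace P T (t lambda : R) : R :=
  fine (\int[inverse_law P T t]_(s in `[0%R, +oo[) (expR (- lambda * s))%:E)%E.

Definition renewal P T (A : set R) : \bar R :=
  (\int[lebesgue_measure]_(t in `[0%R, +oo[) P (T t @^-1` A))%E.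

(* The possible atoms of [renewal P T] at 0 and at [s] (compound Poisson case)
   are included: it is over the closed interval [0, s] that the integral of 1
   is the mean of [inverse_subordinator T s]. *)
Definition renewal_integral P T (s : R) (f : R -> R) : R :=
  fine (\int[renewal P T]_(r in `[0%R, s]) (f r)%:E)%E.

Definition mean_inverse P T (s : R) : R :=
  \int[P]_w fine (inverse_subordinator T s w).

Definition time_changed (dE : measure_display) (E : measurableType dE)
    (X : R -> Omega -> E) T (t : R) (w : Omega) : E :=
  X (fine (inverse_subordinator T t w)) w.

End subordinators.

Section asymptotics.
Context (R : realType).
Implicit Types (f g : R -> R) (a : R).

Definition asymp_bounded a f g : Prop :=
  exists K : R, 0 < K /\ forall x, a <= x -> K^-1 * g x <= f x /\ f x <= K * g x.

(* [f / g --> 1] at infinity, with [0 / 0] read as 1 so that the zero function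
   is equivalent to itself. *)
Definition asymp_equiv f g : Prop :=
  (if (f x == 0) && (g x == 0) then 1 else f x / g x) @[x --> +oo] --> (1 : R).

Definition long_tailed f : Prop :=
  forall y : R, 0 < y -> asymp_equiv (fun x => f (x + y)) f.

End asymptotics.

(* Main.v *)
Require Import Defs.
From HB Require Import structures.
From mathcomp Require Import all_boot all_order all_algebra.
From mathcomp Require Import all_classical all_reals all_analysis.
From mathcomp Require Import measurable_realfun giry.
From mathcomp Require Import ring lra.

Set Implicit Arguments.
Unset Strict Implicit.
Unset Printing Implicit Defensive.

Import Order.TTheory GRing.Theory Num.Theory.
Import numFieldNormedType.Exports.

Local Open Scope classical_set_scope.
Local Open Scope ring_scope.

(** The proof separates the two sources of randomness.

    On the side of [X], the invariant initial law makes the pair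
    [(X v, X u)] stationary ([stationary_pair]), so the mean of
    [f (X u) * g (X v)] is the inner product of [P_(u - v) f] and [g], that is
    [expR (- r * (u - v))] times the inner product of [f] and [g] when [f] is
    an eigenfunction of eigenvalue [r] ([integral_eigenfunction]).  Since the
    inverse subordinator [L] is a function of [T], hence independent of [X],
    Fubini replaces [u] and [v] by [L t] and [L s]
    ([integral_eigenfunction_stopped]): the mean of [f (X_(L t)) * g (X_(L s))]
    is the inner product of [f] and [g] times the mean of
    [expR (- r * (L t - L s))].

    On the side of [T], this exponential moment is computed pathwise.  Writing
    [expR (r * L s) = 1 + r * \int_0^(L s) expR (r * u) du] gives
    [expR (- r * L t)] plus [r] times the integral over the times [u < L s] of
    [expR (- r * (L t - u))].  Up to a null set of times, [u < L s] means
    [T u <= s], and then [L t - u] is the passage time over [t - T u] of the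
    subordinator restarted at [u], which is independent of [T u]
    ([mean_laplace_shift]).  Taking means, the level [T u] integrated over [u]
    is distributed according to the renewal measure, and the formula
    [eta t + r * \int_[0, s] eta (t - y) U(dy)] comes out
    ([renewal_identity]).  The Laplace transform of a passage time is the
    probability that the path is above the level at an independent exponential
    time, which reduces the restart to the increments of [T] between two fixed
    times.

    It remains to see that covariances may be replaced by inner products and
    standard deviations by norms.  An eigenfunction of nonzero eigenvalue is
    centred, so the only delicate case is that of the eigenvalue [0].  A
    function [f] fixed by the semigroup satisfies [f (X 1) = f (X 0)] almost
    surely, hence is orthogonal to every eigenfunction of nonzero eigenvalue
    ([fixed_function_orthogonal]); both sides of the formula then vanish for
    distinct indices, and for equal indices centring is assumed.
    Eigenfunctions and co-eigenfunctions of distinct eigenvalues are orthogonal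
    by adjunction ([coeigenfunction_biorthogonal]).

    The bounds follow from the monotonicity of [eta], and the asymptotics from
    the bounds ([asymp_bounded_sandwich], [asymp_equiv_sandwich]). *)

(** * Independent pairs and the initial law *)

Section independent_pairs.
Local Open Scope ereal_scope.
Context {R : realType} (d d1 d2 : measure_display) {Om : measurableType d}.
Context {T1 : measurableType d1} {T2 : measurableType d2}.
Variables (P : probability Om R) (Y : Om -> T1) (Z : Om -> T2).
Hypotheses (mY : measurable_fun setT Y) (mZ : measurable_fun setT Z).
Hypothesis YZ : forall A B, measurable A -> measurable B ->
  P (Y @^-1` A `&` Z @^-1` B) = P (Y @^-1` A) * P (Z @^-1` B).

HB.instance Definition _ := isMeasurableFun.Build _ _ _ _ Y mY.
HB.instance Definition _ := isMeasurableFun.Build _ _ _ _ Z mZ.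

Let W w := (Y w, Z w).

Let mW : measurable_fun [set: Om] W.
Proof. exact: measurable_fun_pair. Qed.

HB.instance Definition _ := isMeasurableFun.Build _ _ _ _ W mW.

Let lawW A : measurable A ->
  (distribution P Y \x distribution P Z) A = distribution P W A.
Proof.
apply: product_measure_unique => A1 A2 mA1 mA2.
by rewrite /distribution /pushforward -YZ.
Qed.

(** Independence says that the law of [(Y, Z)] and the product of the laws agree
    on rectangles; uniqueness of the product measure and Tonelli do the rest. *)
Lemma ge0_integral_indep (F : T1 * T2 -> \bar R) :
  measurable_fun setT F -> (forall z, 0 <= F z) ->
  \int[P]_w F (Y w, Z w) = \int[P]_w' \int[P]_w F (Y w, Z w').
Proof.
move=> mF F0.
transitivity (\int[distribution P W]_z F z).
  by rewrite ge0_integral_distribution.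
transitivity (\int[distribution P Y \x distribution P Z]_z F z).
  by apply/esym/eq_measure_integral => A mA _; exact: lawW.
rewrite fubini_tonelli2//= /fubini_G ge0_integral_distribution//; last 2 first.
- exact: measurable_fun_fubini_tonelli_G.
- by move=> y; exact: integral_ge0.
apply: eq_integral => w' _ /=.
rewrite ge0_integral_distribution//.
exact: measurableT_comp mF (measurable_pair2 _).
Qed.

Let integral_distributionE d' (T : measurableType d') (V : {mfun Om >-> T})
    (f : T -> \bar R) : measurable_fun setT f ->
  \int[distribution P V]_y f y = \int[P]_w f (V w).
Proof.
move=> mf; rewrite integralE [RHS]integralE.
rewrite (_ : (fun w => f (V w))^\+ = f^\+ \o V); last exact: funepos_comp.
rewrite (_ : (fun w => f (V w))^\- = f^\- \o V); last exact: funeneg_comp.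
by rewrite !ge0_integral_distribution//;
  [exact: measurable_funeneg|exact: measurable_funepos].
Qed.

Lemma integral_indep (F : T1 * T2 -> \bar R) :
  measurable_fun setT F -> P.-integrable setT (fun w => F (Y w, Z w)) ->
  \int[P]_w F (Y w, Z w) = \int[P]_w' \int[P]_w F (Y w, Z w').
Proof.
move=> mF iF.
have iF' : (distribution P Y \x distribution P Z).-integrable setT F.
  apply/integrableP; split=> //.
  rewrite (eq_measure_integral (distribution P W)); last first.
    by move=> A mA _; exact: lawW.
  rewrite ge0_integral_distribution//; last exact: measurableT_comp.
  by have /integrableP[] := iF.
transitivity (\int[distribution P W]_z F z).
  by rewrite integral_distributionE.
transitivity (\int[distribution P Y \x distribution P Z]_z F z).
  by apply/esym/eq_measure_integral => A mA _; exact: lawW.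
rewrite -integral21_prod_meas1// integral_distributionE; last first.
  rewrite /fubini_G.
  rewrite (_ : (fun y => _) =
      (fun y => \int[distribution P Y]_x F^\+ (x, y)) \-
      (fun y => \int[distribution P Y]_x F^\- (x, y))); last first.
    apply/funext => y /=; rewrite integralE.
    by congr (_ - _); apply: eq_integral => x _; rewrite !(funeposE, funenegE).
  apply: emeasurable_funB.
  - apply: (measurable_fun_fubini_tonelli_G F^\+) => //.
    exact: measurable_funepos.
  - apply: (measurable_fun_fubini_tonelli_G F^\-) => //.
    exact: measurable_funeneg.
apply: eq_integral => w' _ /=.
rewrite /fubini_G integral_distributionE//.
exact: measurableT_comp mF (measurable_pair2 _).
Qed.

End independent_pairs.

Section integral_initial_law.
Local Open Scope ereal_scope.
Context {R : realType} {dE dO : measure_display}.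
Context {E : measurableType dE} {Omega : measurableType dO}.
Variables (Px : R.-pker E ~> Omega) (nu : probability E R).

(* the kernel at [x], as a bundled probability to which Giry integration applies *)
Let Q x (A : set Omega) := Px x A.

Let Q_setT x : Q x setT = 1. Proof. exact: prob_kernel. Qed.

HB.instance Definition _ x := isMeasure.Build _ _ _ (Q x)
  (measure0 (Px x)) (@measure_ge0 _ _ _ (Px x))
  (@measure_semi_sigma_additive _ _ _ (Px x)).

HB.instance Definition _ x := Measure_isProbability.Build _ _ _ (Q x) (Q_setT x).

Let mPx : measurable_fun setT (fun x => Q x : giry Omega R).
Proof.
apply: measurable_giry_codensity => // B mB.
exact: measurable_kernel.
Qed.

Let measurable_integral_kernel (F : Omega -> \bar R) :
  measurable_fun setT F -> (forall w, 0 <= F w) ->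
  measurable_fun setT (fun x => \int[Px x]_w F w).
Proof.
move=> mF F0.
exact: (measurableT_comp (measurable_giry_int mF F0) mPx).
Qed.

Lemma measurable_integral_pker (F : Omega -> \bar R) :
  measurable_fun setT F -> measurable_fun setT (fun x => \int[Px x]_w F w).
Proof.
move=> mF; rewrite (_ : (fun x => _) =
  (fun x => \int[Px x]_w F^\+ w) \- (fun x => \int[Px x]_w F^\- w)).
  apply: emeasurable_funB; apply: measurable_integral_kernel => //.
  - exact: measurable_funepos.
  - exact: measurable_funeneg.
by apply/funext => x; rewrite integralE.
Qed.

(** [Pinit] is the bind of the Giry monad, which has this disintegration. *)
Lemma ge0_integral_Pinit (F : Omega -> \bar R) :
  measurable_fun setT F -> (forall w, 0 <= F w) ->
  \int[Pinit Px nu]_w F w = \int[nu]_x \int[Px x]_w F w.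
Proof.
move=> mF F0.
have := @giry_int_bind _ _ _ _ R nu _ mPx F mF F0.
rewrite /giry_int => <-.
apply: eq_measure_integral => A mA _.
rewrite /giry_bind /= /giry_int /Pinit /giry_ev.
rewrite [RHS]ge0_integral_pushforward//.
exact: measurable_giry_ev.
Qed.

Lemma integrable_Pinit_ae (F : Omega -> \bar R) :
  (Pinit Px nu).-integrable setT F ->
  {ae nu, forall x, (Px x).-integrable setT F}.
Proof.
move=> /integrableP[mF]; rewrite ge0_integral_Pinit//; last first.
  exact: measurableT_comp.
move=> iF.
have : nu.-integrable setT (fun x => \int[Px x]_w `|F w|).
  apply/integrableP; split.
    by apply: measurable_integral_kernel => //; exact: measurableT_comp.
  under eq_integral do rewrite gee0_abs ?integral_ge0//.
  exact: iF.
move=> /integrable_ae => /(_ measurableT).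
apply: filterS => x /= /(_ I) h; apply/integrableP; split => //.
by move/fin_numPlt : h => /andP[].
Qed.

Lemma integral_Pinit (F : Omega -> \bar R) :
  (Pinit Px nu).-integrable setT F ->
  \int[Pinit Px nu]_w F w = \int[nu]_x \int[Px x]_w F w.
Proof.
move=> iF; have mF := measurable_int _ iF.
have fin (G : Omega -> \bar R) : (forall w, 0 <= G w) ->
    (Pinit Px nu).-integrable setT G ->
    nu.-integrable setT (fun x => \int[Px x]_w G w).
  move=> G0 /integrableP[mG iG]; apply/integrableP; split.
    exact: measurable_integral_kernel.
  under eq_integral do rewrite gee0_abs ?integral_ge0//.
  rewrite -ge0_integral_Pinit//.
  by under eq_integral do rewrite -[G _]gee0_abs//.
rewrite integralE !ge0_integral_Pinit//;
  [|exact: measurable_funeneg|exact: measurable_funepos].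
rewrite -integralB//.
- by apply: eq_integral => x _; rewrite [RHS]integralE.
- by apply: fin => //; exact: integrable_funepos.
- by apply: fin => //; exact: integrable_funeneg.
Qed.

End integral_initial_law.

(** * Paths of the inverse subordinator *)

Section indicators_of_half_lines.
Context {R : realType}.
Implicit Types c x : R.

Lemma indic_itvcy c x : (\1_(`[c, +oo[%classic) x : R) = (c <= x)%R%:R.
Proof. by rewrite indicE mem_setE in_itv/= andbT. Qed.

Lemma indic_itvoy c x : (\1_(`]c, +oo[%classic) x : R) = (c < x)%R%:R.
Proof. by rewrite indicE mem_setE in_itv/= andbT. Qed.

Lemma indic_itvNyc c x : (\1_(`]-oo, c]%classic) x : R) = (x <= c)%R%:R.
Proof. by rewrite indicE mem_setE in_itv. Qed.

End indicators_of_half_lines.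

Section inverse_subordinator_paths.
Context {R : realType} {dO : measure_display} {Om : measurableType dO}.
Variable T : R -> Om -> R.
Hypothesis T_nd : forall w (s t : R), 0 <= s -> s <= t -> T s w <= T t w.
Hypothesis T_rc : forall w (t : R), 0 <= t -> T u w @[u --> t^'+] --> T t w.
Hypothesis mT : forall t : R, 0 <= t -> measurable_fun [set: Om] (T t).

Local Notation inv := (inverse_subordinator T).

Lemma inverse_subordinator_ge0 t w : (0 <= inv t w)%E.
Proof. by apply: le_ereal_inf_tmp => _ [s [/ltW s0 _] <-]; rewrite lee_fin. Qed.

Lemma inverse_subordinator_le t u w : 0 < u -> t < T u w -> (inv t w <= u%:E)%E.
Proof. by move=> u0 tu; apply: ereal_inf_lbound; exists u. Qed.

Lemma inverse_subordinator_lt t u w : (inv t w < u%:E)%E -> t < T u w.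
Proof.
move=> /ereal_inf_lt[_ [s [s0 ts] <-]]; rewrite lte_fin => su.
by rewrite (lt_le_trans ts)// T_nd// ltW.
Qed.

Lemma le_inverse_subordinator s t w : s <= t -> (inv s w <= inv t w)%E.
Proof.
move=> st; apply: ereal_inf_le_tmp => _ [u [u0 tu] <-]; exists u => //.
by split => //; exact: le_lt_trans tu.
Qed.

(** [{inv t < u}] is the union of the events [{t < T q}] over the rationals
    [0 < q < u], because the paths are monotone. *)
Lemma measurable_inverse_subordinator t : measurable_fun [set: Om] (inv t).
Proof.
apply: (measurability _ (ErealGenInftyO.measurableE R)) => _ [_ [u ->] <-].
rewrite setTI.
rewrite (_ : _ @^-1` _ = \bigcup_q
   (if (0 < ratr q :> R) && (ratr q < u) then [set w | t < T (ratr q) w]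
    else set0)).
  apply: bigcupT_measurable_rat => q; case: ifPn => // /andP[q0 _].
  rewrite -[X in measurable X]setTI.
  by have /(_ measurableT _ (measurable_itv `]t, +oo[)) := mT (ltW q0);
     rewrite preimage_itvoy.
apply/seteqP; split => w /=.
  rewrite in_itv/= => h.
  have [_ [s [s0 ts] <-]] := ereal_inf_lt h; rewrite lte_fin => su.
  have [q] := rat_in_itvoo su; rewrite in_itv/= => /andP[sq qu].
  exists q => //; rewrite qu (lt_trans s0 sq)/=.
  by rewrite (lt_le_trans ts)// T_nd// ltW.
move=> [q _]; case: ifPn => // /andP[q0 qu] /= tq.
by rewrite in_itv/= (le_lt_trans (inverse_subordinator_le q0 tq))// lte_fin.
Qed.

(** Freezing the path at its starting point for negative times makes it a
    function on the whole of [R * Om], so that joint measurability and Tonelli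
    involve no restriction of the time set. *)
Definition extended_path (p : R * Om) : R := T (Num.max p.1 0) p.2.

Local Notation tau := extended_path.

Lemma extended_pathE u w : 0 <= u -> tau (u, w) = T u w.
Proof. by move=> u0; rewrite /extended_path/= max_l. Qed.

(** Right-continuity and monotonicity make [{T < a}] the union, over the
    rationals [q], of the measurable rectangles [{u < q}] x [{T q < a}]. *)
Lemma measurable_extended_path : measurable_fun [set: R * Om] tau.
Proof.
apply: (measurability _ (RGenInftyO.measurableE R)) => _ [_ [a ->] <-].
rewrite setTI.
rewrite (_ : _ @^-1` _ = \bigcup_q
   (if (0 < ratr q :> R)
    then [set u : R | u < ratr q] `*` [set w | T (ratr q) w < a]
    else set0)).
  apply: bigcupT_measurable_rat => q; case: ifPn => // q0.
  apply: measurableX.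
    by rewrite -[X in measurable X]set_itvE; exact: measurable_itv.
  rewrite -[X in measurable X]setTI.
  by have /(_ measurableT _ (measurable_itv `]-oo, a[)) := mT (ltW q0);
     rewrite preimage_itvNyo.
apply/seteqP; split => -[u w] /=; rewrite in_itv/= /tau /=.
  move=> Tu.
  have m0 : 0 <= Num.max u 0 by rewrite le_max lexx orbT.
  have : \forall v \near (Num.max u 0)^'+, T v w < a.
    exact: (cvgr_lt (T (Num.max u 0) w) (T_rc m0) a Tu).
  rewrite near_withinE => -[e /= e0 he].
  have : Num.max u 0 < Num.max u 0 + e by rewrite ltrDl.
  move=> /rat_in_itvoo[q]; rewrite in_itv/= => /andP[uq qe].
  exists q => //; rewrite (le_lt_trans m0 uq) /=; split => /=.
    by rewrite (le_lt_trans _ uq)// le_max lexx.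
  apply: he => //=; rewrite /ball/= ltr0_norm ?subr_lt0//.
  by rewrite opprB ltrBlDl.
move=> [q _]; case: ifPn => // q0 [/= uq]; apply: le_lt_trans.
by rewrite T_nd// ?le_max ?lexx ?orbT// ge_max !ltW.
Qed.

End inverse_subordinator_paths.

(** * Exponential clocks *)

Section exponential_law.
Context {R : realType}.
Variables (l : R) (l0 : 0 < l).

Definition exponential_law : probability (measurableTypeR R) R.
Proof. refine (exponential_prob l); exact: l0. Defined.

Let mpdf (A : set R) : measurable_fun A (EFin \o exponential_pdf l).
Proof.
by apply: measurable_funTS; apply/measurable_EFinP;
   exact: measurable_exponential_pdf.
Qed.

Lemma exponential_law_ge x : 0 <= x ->
  exponential_law `[x, +oo[%classic = (expR (- l * x))%:E.
Proof.
move=> x0; rewrite /exponential_law/= /exponential_prob.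
have cexp : continuous (fun z : R => expR (- l * z)).
  move=> z; apply: continuous_comp; last exact: continuous_expR.
  by apply: continuousM => //; apply: (@continuousN _ R^o); exact: cst_continuous.
rewrite (@ge0_continuous_FTC2y _ _ (fun z => - (expR (- l * z))) _ 0)//.
- by rewrite sub0e EFinN oppeK.
- by move=> z _; apply: exponential_pdf_ge0; exact: ltW.
- apply: (@continuous_subspaceW R^o _ _ [set` `[0, +oo[%R]).
    by apply: subset_itvr; rewrite bnd_simp.
  exact: within_continuous_exponential_pdf.
- rewrite -oppr0; apply: cvgN.
  rewrite (_ : (fun z => expR (- l * z)) =
               (fun z => expR (- z)) \o (fun z => l * z)); last first.
    by apply: eq_fun => z; rewrite mulNr.
  apply: (@cvg_comp _ _ _ _ _ _ (pinfty_nbhs R)); last exact: cvgr_expR.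
  exact: gt0_cvgMry.
- by apply: cvgN; apply/cvg_at_right_filter; exact: cexp.
- move=> z; rewrite in_itv/= andbT => xz.
  by apply: derive1_exponential_pdf; rewrite in_itv/= andbT (le_lt_trans x0).
Qed.

Lemma exponential_law_gt x : 0 <= x ->
  exponential_law `]x, +oo[%classic = (expR (- l * x))%:E.
Proof.
move=> x0; rewrite -exponential_law_ge// /exponential_law/= /exponential_prob.
exact: integral_itv_obnd_cbnd.
Qed.

(** The exponential law has no atom, so the boundary point of a half-line does
    not matter; this absorbs the gap between [u < L t] and [T u <= t]. *)
Lemma exponential_law_tail (A : set R) x : 0 <= x -> measurable A ->
  `]x, +oo[%classic `<=` A -> A `<=` `[x, +oo[%classic ->
  exponential_law A = (expR (- l * x))%:E.
Proof.
move=> x0 mA xA Ax; apply/eqP; rewrite eq_le; apply/andP; split.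
  rewrite -exponential_law_ge//; apply: le_measure => //; rewrite inE//.
rewrite -exponential_law_gt//; apply: le_measure => //; rewrite inE//.
Qed.

End exponential_law.

Section exponential_clock.
Context {R : realType} {dO : measure_display} {Om : measurableType dO}.
Variable T : R -> Om -> R.
Hypothesis T_nd : forall w (s t : R), 0 <= s -> s <= t -> T s w <= T t w.
Hypothesis T_rc : forall w (t : R), 0 <= t -> T u w @[u --> t^'+] --> T t w.
Hypothesis mT : forall t : R, 0 <= t -> measurable_fun [set: Om] (T t).
Variables (l : R) (l0 : 0 < l).

Local Notation inv := (inverse_subordinator T).
Local Notation tau := (extended_path T).

Lemma inverse_subordinator_lb t u w : 0 <= u -> T u w <= t ->
  (u%:E <= inv t w)%E.
Proof.
move=> u0 Tut; rewrite leNgt; apply/negP => /inverse_subordinator_lt.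
by move=> /(_ T_nd); rewrite ltNge Tut.
Qed.

Lemma measurable_passage t u w : measurable [set y : R | t < tau (u + y, w)].
Proof.
have mtau := measurable_extended_path T_nd T_rc mT.
have : measurable_fun [set: R] (fun y => tau (u + y, w)).
  apply: (measurableT_comp mtau) => /=; apply/measurable_fun_pair => //.
  exact: measurable_funD.
move=> /(_ measurableT _ (measurable_itv `]t, +oo[)).
by rewrite setTI preimage_itvoy.
Qed.

(** The probability that an exponential time [y] satisfies [t < T (u + y)] is
    that of [y] exceeding the remaining passage time [L t - u]: the Laplace
    transform of a passage time becomes the probability of an event about the
    path at one time. *)
Lemma exponential_passage t u w : 0 <= u -> T u w <= t -> (inv t w < +oo)%E ->
  exponential_law l0 [set y : R | t < tau (u + y, w)] =
  (expR (- l * (fine (inv t w) - u)))%:E.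
Proof.
move=> u0 Tut invy; have ui := inverse_subordinator_lb u0 Tut.
have invE : inv t w = (fine (inv t w))%:E.
  by rewrite fineK// fin_real// invy (lt_le_trans _ ui)// ltNyr.
move: ui; rewrite invE lee_fin /= => ui.
apply: exponential_law_tail => //.
- by rewrite subr_ge0.
- exact: measurable_passage.
- move=> y /=; rewrite in_itv/= andbT ltrBlDl => h.
  rewrite /extended_path/= max_l; last by rewrite (le_trans _ (ltW h))// (le_trans u0).
  by apply: (inverse_subordinator_lt T_nd); rewrite invE lte_fin.
- move=> y /=; rewrite in_itv/= andbT /extended_path/= lerBlDl.
  have [uy0|uy0] := leP (u + y) 0.
    by rewrite ltNge (le_trans _ Tut)// T_nd.
  by move=> /(inverse_subordinator_le uy0); rewrite invE lee_fin.
Qed.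

End exponential_clock.

(** * Laplace transform of the inverse subordinator *)

Section integral_of_set_functions.
Local Open Scope ereal_scope.
Context {d : measure_display} {T : measurableType d} {R : realType}.

Import HBNNSimple.

(** [renewal] and [inverse_law] are given as plain set functions; their values on
    measurable sets determine the integral, whose definition only evaluates the
    measure on level sets of simple functions. *)
Lemma eq_integral_set_function (m1 m2 : set T -> \bar R) (D : set T) f :
  (forall A, measurable A -> m1 A = m2 A) ->
  \int[m1]_(x in D) f x = \int[m2]_(x in D) f x.
Proof.
move=> m12.
have sint (h : {nnsfun T >-> R}) : sintegral m1 h = sintegral m2 h.
  by apply: eq_fsbigr => r _; rewrite m12.
rewrite /integral; congr (ereal_sup _ - ereal_sup _);
  by apply: eq_imagel => h _; exact: sint.
Qed.

End integral_of_set_functions.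

Section equal_laws.
Local Open Scope ereal_scope.
Context {R : realType} {d d' : measure_display}.
Context {Om : measurableType d} {S : measurableType d'}.

Lemma ge0_integral_eq_law (P : probability Om R) (Y Y' : Om -> S)
    (G : S -> \bar R) :
  measurable_fun setT Y -> measurable_fun setT Y' ->
  (forall B, measurable B -> P (Y @^-1` B) = P (Y' @^-1` B)) ->
  measurable_fun setT G -> (forall y, 0 <= G y) ->
  \int[P]_w G (Y w) = \int[P]_w G (Y' w).
Proof.
move=> mY mY' YY' mG G0.
transitivity (\int[pushforward P Y]_y G y).
  by rewrite ge0_integral_pushforward.
transitivity (\int[pushforward P Y']_y G y).
  exact: eq_integral_set_function.
by rewrite ge0_integral_pushforward.
Qed.

End equal_laws.

Section inverse_laplace.
Context {R : realType} {dO : measure_display} {Om : measurableType dO}.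
Variables (P : probability Om R) (T : R -> Om -> R).
Hypothesis hT : subordinator P T.
Hypothesis hfin : forall t : R, 0 <= t ->
  P [set w | (inverse_subordinator T t w < +oo)%E] = 1%E.

Local Notation inv := (inverse_subordinator T).
Local Notation tau := (extended_path T).

Let T_nd := @sub_nondecreasing _ _ _ _ _ hT.
Let T_rc := @sub_right_continuous _ _ _ _ _ hT.
Let mT := @sub_measurable _ _ _ _ _ hT.

Lemma measurable_path : measurable_fun setT tau.
Proof. exact: measurable_extended_path. Qed.

Lemma measurable_below_level s :
  measurable_fun setT (fun p => \1_(`]-oo, s]%classic) (tau p) : R).
Proof.
by apply: measurableT_comp; [exact: measurable_indic|exact: measurable_path].
Qed.

Lemma measurable_fine_inverse t :
  measurable_fun setT (fun w => fine (inv t w)).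
Proof.
by apply: measurableT_comp => //; exact: measurable_inverse_subordinator.
Qed.

Lemma fine_inverse_ge0 t w : 0 <= fine (inv t w).
Proof. by rewrite fine_ge0// inverse_subordinator_ge0. Qed.

Lemma inverse_ae_finite t : 0 <= t -> {ae P, forall w, (inv t w < +oo)%E}.
Proof.
move=> t0; have mA : measurable [set w | (inv t w < +oo)%E].
  have minv := measurable_inverse_subordinator T_nd mT t.
  by rewrite -[X in measurable X]setTI; exact: emeasurable_fun_infty_o.
exists (~` [set w | (inv t w < +oo)%E]); split => //.
  exact: measurableC.
by rewrite probability_setC// hfin// subee.
Qed.

(** [inverse_laplace] before truncation to a real number: extended-real valued,
    it can enter Tonelli arguments directly. *)
Definition mean_laplace (l t : R) : \bar R :=
  \int[P]_w (expR (- l * fine (inv t w)))%:E.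

Lemma mean_laplace_ge0 l t : (0 <= mean_laplace l t)%E.
Proof. by apply: integral_ge0 => w _; rewrite lee_fin expR_ge0. Qed.

Lemma measurable_inverse_exp (l t u : R) :
  measurable_fun setT (fun w => expR (- l * (fine (inv t w) - u))).
Proof.
apply: measurableT_comp => //; apply: measurable_funM => //.
by apply: measurable_funB => //; exact: measurable_fine_inverse.
Qed.

Lemma mean_laplace_le1 l t : 0 <= l -> (mean_laplace l t <= 1)%E.
Proof.
move=> l0; rewrite -(@probability_setT _ _ _ P) -[leRHS]mul1e -integral_cst//.
apply: ge0_le_integral => //.
- apply/measurable_EFinP.
  apply: (eq_measurable_fun (fun w => expR (- l * (fine (inv t w) - 0)))).
    by move=> w _; rewrite subr0.
  exact: measurable_inverse_exp.
- by move=> w _; rewrite lee_fin -expR0 ler_expR mulNr oppr_le0 mulr_ge0// fine_inverse_ge0.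
Qed.

Lemma inverse_laplaceE l t : inverse_laplace P T t l = fine (mean_laplace l t).
Proof.
rewrite /inverse_laplace /inverse_law; congr fine.
rewrite (ge0_integral_pushforward (measurable_fine_inverse t))//.
  congr (integral _ _); apply/seteqP; split=> // w _ /=.
  by rewrite in_itv/= andbT fine_inverse_ge0.
apply/measurable_EFinP; apply: measurable_funTS.
by apply: measurableT_comp => //; exact: measurable_funM.
Qed.

Lemma mean_laplaceE l t : 0 <= l ->
  mean_laplace l t = (inverse_laplace P T t l)%:E.
Proof.
move=> l0; rewrite inverse_laplaceE fineK// ge0_fin_numE ?mean_laplace_ge0//.
by rewrite (le_lt_trans (mean_laplace_le1 t l0))// ltry.
Qed.

End inverse_laplace.

(** * Restarting the subordinator at a fixed time *)

Section passage.
Context {R : realType} {dO : measure_display} {Om : measurableType dO}.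
Variables (P : probability Om R) (T : R -> Om -> R).
Hypothesis hT : subordinator P T.
Hypothesis hfin : forall t : R, 0 <= t ->
  P [set w | (inverse_subordinator T t w < +oo)%E] = 1%E.
Variables (l : R) (l0 : 0 < l).

Local Notation inv := (inverse_subordinator T).
Local Notation tau := (extended_path T).
Local Notation expo := (exponential_law l0).

Let T_nd := @sub_nondecreasing _ _ _ _ _ hT.
Let T_rc := @sub_right_continuous _ _ _ _ _ hT.
Let T_start := @sub_start _ _ _ _ _ hT.
Let mT := @sub_measurable _ _ _ _ _ hT.

Let mtau := measurable_path hT.

(* The event [T u <= s], [t < T u + increment], as a function of [T u] and of
   the increment. *)
Let F (s t : R) (q : R * R) : \bar R :=
  (\1_(`]-oo, s]%classic) q.1 * \1_(`]t, +oo[%classic) (q.1 + q.2))%:E.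

Let F_ge0 s t q : (0 <= F s t q)%E.
Proof. by rewrite lee_fin mulr_ge0// indicE. Qed.

Let mF s t : measurable_fun setT (F s t).
Proof.
apply/measurable_EFinP; apply: measurable_funM.
  by apply: measurableT_comp => //; exact: measurable_indic.
apply: measurableT_comp => /=; first exact: measurable_indic.
exact: measurable_funD.
Qed.

Let integral_expo_indic (c : R) (A : set R) : 0 <= c -> measurable A ->
  (\int[expo]_y (c * \1_A y)%:E = c%:E * expo A)%E.
Proof.
move=> c0 mA; under eq_integral do rewrite EFinM.
by rewrite ge0_integralZl// ?integral_indic ?setIT//; apply/measurable_EFinP.
Qed.

Let stopped_path s t u w : 0 <= u -> s <= t ->
  (inv t w < +oo)%E ->
  (\int[expo]_y F s t (T u w, (tau ((u + y)%R, w) - T u w)%R))%E =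
  (\1_(`]-oo, s]%classic) (T u w) * expR (- l * (fine (inv t w) - u)))%:E.
Proof.
move=> u0 st invy; rewrite /F/=.
under eq_integral do rewrite subrKC.
rewrite (eq_integral (fun y : measurableTypeR R => ((\1_(`]-oo, s]%classic) (T u w)) *
    \1_[set y | t < tau (u + y, w)] y)%:E)); last first.
  move=> y _; rewrite indic_itvoy [in RHS]indicE.
  by congr (_ * (nat_of_bool _)%:R)%:E; apply/idP/idP; rewrite inE.
rewrite integral_expo_indic ?indicE//; last exact: measurable_passage.
rewrite -indicE indic_itvNyc; case: leP => [Tus|_]; last by rewrite mul0e mul0r.
by rewrite (exponential_passage T_nd T_rc mT)// (le_trans Tus).
Qed.

Lemma mean_laplace_passage t : 0 <= t ->
  mean_laplace P T l t =
  (\int[P]_w \int[expo]_y (\1_(`]t, +oo[%classic) (tau (y, w)))%:E)%E.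
Proof.
move=> t0.
have mind : measurable_fun setT (fun p : Om * measurableTypeR R =>
    (\1_(`]t, +oo[%classic) (tau (p.2, p.1)) : R)%:E).
  apply/measurable_EFinP.
  apply: measurableT_comp => /=; first exact: measurable_indic.
  by apply: (measurableT_comp mtau); exact: measurable_fun_pair.
apply: ae_eq_integral => //.
- apply/measurable_EFinP.
  apply: (eq_measurable_fun (fun w => expR (- l * (fine (inv t w) - 0)))).
    by move=> w _; rewrite subr0.
  exact: (measurable_inverse_exp hT).
- apply: (measurable_fun_fubini_tonelli_F _ mind) => p.
  by rewrite lee_fin indicE.
- apply: filterS (inverse_ae_finite hT hfin t0) => w invy _.
  have := @stopped_path t t 0 w (lexx 0) (lexx t) invy.
  rewrite T_start subr0 indic_itvNyc t0 mul1r => <-.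
  apply: eq_integral => y _; rewrite /F/= add0r subr0 add0r.
  by rewrite indic_itvNyc t0 mul1r.
Qed.

Let increment_law s t u y w' : 0 <= u -> 0 <= y ->
  (\int[P]_w F s t (T u w', (T (u + y) w - T u w)%R) =
   \int[P]_w F s t (T u w', T y w))%E.
Proof.
move=> u0 y0; apply: (@ge0_integral_eq_law _ _ _ _ _ P
  (fun w => T (u + y) w - T u w) (T y) (fun b => F s t (T u w', b))).
- by apply: measurable_funB; apply: mT => //; exact: addr_ge0.
- exact: mT.
- by move=> B mB; exact: (sub_stationary_increments hT).
- by apply: (measurableT_comp (mF s t)); exact: measurable_fun_pair.
- by move=> b; exact: F_ge0.
Qed.

Let history_path u A : 0 <= u -> measurable A ->
  history `[0, u]%classic T (T u @^-1` A).
Proof.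
move=> u0 mA; apply: sub_gen_smallest; exists u, A; split => //.
by rewrite /= in_itv/= u0 lexx.
Qed.

(** For [y < 0] both sides vanish, since [T (u + y) <= T u <= s <= t]; this keeps
    the identity valid for all real [y], as integration against the exponential
    law requires. *)
Let joint_passage s t u y : 0 <= u -> s <= t ->
  (\int[P]_w F s t (T u w, (tau ((u + y)%R, w) - T u w)%R) =
   \int[P]_w' \int[P]_w F s t (T u w', tau (y, w)))%E.
Proof.
move=> u0 st; have [y0|/ltW y0] := leP 0 y; last first.
  rewrite integral0_eq; last first.
    move=> w _; rewrite /F/= subrKC indic_itvNyc indic_itvoy.
    case: (leP (T u w) s) => [Tus|_]; last by rewrite mul0r.
    rewrite ltNge (le_trans _ st) ?mulr0// (le_trans _ Tus)//.
    by rewrite /extended_path/= T_nd// ?le_max ?lexx ?orbT// ge_max u0 gerDl y0.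
  rewrite integral0_eq// => w' _; rewrite integral0_eq// => w _.
  rewrite /F/= /extended_path/= max_r// T_start addr0 indic_itvNyc indic_itvoy.
  case: (leP (T u w') s) => [Tus|_]; last by rewrite mul0r.
  by rewrite ltNge (le_trans Tus st) mulr0.
under eq_integral do rewrite extended_pathE ?addr_ge0//.
under [RHS]eq_integral do under eq_integral do rewrite extended_pathE//.
transitivity (\int[P]_w' \int[P]_w F s t (T u w', (T (u + y) w - T u w)%R))%E;
  last by apply: eq_integral => w' _; exact: increment_law.
have mswap : measurable_fun setT (fun q : R * R => F s t (q.2, q.1)).
  by apply: (measurableT_comp (mF s t)); exact: measurable_fun_pair.
apply: (@ge0_integral_indep _ _ _ _ _ _ _ P (fun w => T (u + y) w - T u w) (T u)
  _ _ _ (fun q => F s t (q.2, q.1))) => //.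
- by apply: measurable_funB; apply: mT => //; exact: addr_ge0.
- exact: mT.
- move=> A B mA mB; rewrite setIC (sub_independent_increments hT)//.
    by rewrite muleC.
  exact: history_path.
Qed.

(** After time [u], the passage over the level [t] is the passage over the level
    [t - T u] by an independent copy of the subordinator. *)
Lemma mean_laplace_shift s t u : 0 <= u -> 0 <= s -> s <= t ->
  (\int[P]_w (\1_(`]-oo, s]%classic) (T u w) *
              expR (- l * (fine (inv t w) - u)))%:E =
   \int[P]_w ((\1_(`]-oo, s]%classic) (T u w) : R)%:E *
              mean_laplace P T l (t - T u w)))%E.
Proof.
move=> u0 s0 st; have t0 : 0 <= t by exact: le_trans st.
pose K (p : Om * measurableTypeR R) : \bar R :=
  F s t (T u p.1, tau (u + p.2, p.1) - T u p.1).
have mK : measurable_fun setT K.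
  apply: (measurableT_comp (mF s t)) => /=.
  have mTu : measurable_fun setT (fun p : Om * measurableTypeR R => T u p.1).
    by apply: measurableT_comp => //; exact: mT.
  apply: measurable_fun_pair => //; apply: measurable_funB => //.
  apply: (measurableT_comp mtau) => /=; apply: measurable_fun_pair => //.
  exact: measurable_funD.
transitivity (\int[P]_w \int[expo]_y K (w, y))%E.
  apply: ae_eq_integral => //.
  - apply/measurable_EFinP; apply: measurable_funM.
      by apply: measurableT_comp; [exact: measurable_indic|exact: mT].
    exact: (measurable_inverse_exp hT).
  - by apply: (measurable_fun_fubini_tonelli_F _ mK) => p; exact: F_ge0.
  - apply: filterS (inverse_ae_finite hT hfin t0) => w invy _.
    by rewrite -stopped_path.
rewrite (fubini_tonelli K mK); last by move=> p; exact: F_ge0.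
under eq_integral do rewrite joint_passage//.
pose H (p : (Om * measurableTypeR R) * Om) : \bar R :=
  F s t (T u p.1.1, tau (p.1.2, p.2)).
have mH : measurable_fun setT H.
  apply: (measurableT_comp (mF s t)) => /=; apply: measurable_fun_pair.
    apply: (@measurableT_comp _ _ _ _ _ _ (T u)); first exact: mT.
    exact: measurableT_comp.
  apply: (measurableT_comp mtau) => /=; apply: measurable_fun_pair => //.
  exact: measurableT_comp.
have H0 p : (0 <= H p)%E by exact: F_ge0.
have mH1 := measurable_fun_fubini_tonelli_F _ mH H0 (m2 := P).
rewrite -(fubini_tonelli _ mH1); last by move=> p; exact: integral_ge0.
apply: eq_integral => w' _; rewrite /fubini_F /H/=.
rewrite -(@fubini_tonelli _ _ _ _ _ P expo
  (fun p => F s t (T u w', tau (p.2, p.1)))); last 2 first.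
- apply: (measurableT_comp (mF s t)) => /=; apply: measurable_fun_pair => //.
  by apply: (measurableT_comp mtau) => /=; exact: measurable_fun_pair.
- by move=> p; exact: F_ge0.
rewrite /F/= indic_itvNyc; case: (leP (T u w') s) => [Tus|_]; last first.
  rewrite mul0e integral0_eq// => w _.
  by rewrite integral0_eq// => y _; rewrite mul0r.
have tTu : 0 <= t - T u w' by rewrite subr_ge0 (le_trans Tus).
rewrite mul1e (mean_laplace_passage tTu).
apply: eq_integral => w _; congr (integral _ _ _); apply/funext => y.
by rewrite mul1r !indic_itvoy ltrBlDl.
Qed.

End passage.

(** * The renewal measure *)

Section restricted_measure.
Local Open Scope ereal_scope.
Context {d : measure_display} {T : measurableType d} {R : realType}.

Lemma ge0_integral_mrestr (m : {measure set T -> \bar R}) (D : set T)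
    (mD : measurable D) (f : T -> \bar R) :
  measurable_fun setT f -> (forall x, 0 <= f x) ->
  \int[mrestr m mD]_x f x = \int[m]_(x in D) f x.
Proof.
move=> mf f0; rewrite -(setUv D) ge0_integral_setU//; last 3 first.
- exact: measurableC.
- by rewrite setUv.
- exact/disj_setPCl.
rewrite [X in _ + X]null_set_integral ?adde0//; last 3 first.
- exact: measurableC.
- exact: measurable_funTS.
- by rewrite /= /mrestr setIC setICr measure0.
by apply: eq_measure_integral => A mA AD; rewrite /= /mrestr setIidl.
Qed.

End restricted_measure.

Section exponential_primitive.
Context {R : realType}.

Lemma integral_exp_shift (l a b : R) : 0 < l -> 0 <= a ->
  (\int[lebesgue_measure]_(u in `[0%R, a]) (l * expR (- l * (b - u)))%:E =
   (expR (- l * (b - a)) - expR (- l * b))%:E)%E.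
Proof.
move=> l0; rewrite le_eqVlt => /predU1P[<-|a0].
  by rewrite set_itv1 integral_set1 subr0 subrr.
pose G (u : R) := expR (- l * (b - u)).
have dG (u : R) : is_derive u 1 G (l * expR (- l * (b - u))).
  rewrite /G; apply: is_derive_eq.
  by rewrite /GRing.scale/=; ring.
have cG : continuous G.
  move=> u; apply: differentiable_continuous; apply/derivable1_diffP.
  exact: ex_derive.
rewrite (@continuous_FTC2 _ _ G _ _ a0).
- by rewrite /G subr0 EFinB.
- apply: continuous_subspaceT => u.
  by apply: (@continuousM _ R^o (fun=> l) G); [exact: cst_continuous|exact: cG].
- split.
  + by move=> u _; exact: ex_derive.
  + by apply: cvg_at_right_filter; exact: cG.
  + by apply: cvg_at_left_filter; exact: cG.
- by move=> u _; rewrite derive1E; exact: derive_val.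
Qed.

End exponential_primitive.

Section renewal.
Context {R : realType} {dO : measure_display} {Om : measurableType dO}.
Variables (P : probability Om R) (T : R -> Om -> R).
Hypothesis hT : subordinator P T.

Local Notation inv := (inverse_subordinator T).
Local Notation tau := (extended_path T).
Local Notation leb := (@lebesgue_measure R).
Local Notation pos := (\1_(`[0, +oo[%classic) : R -> R).
Local Notation below s := (\1_(`]-oo, s]%classic) : R -> R).

Let T_nd := @sub_nondecreasing _ _ _ _ _ hT.
Let T_start := @sub_start _ _ _ _ _ hT.

Let mbelow := measurable_below_level hT.

(** At every time [u] other than [L s], being below the level [s] amounts to
    preceding the passage time [L s]; a single time is negligible. *)
Lemma occupation_integral s w (h : R -> \bar R) : 0 <= s ->
  (inv s w < +oo)%E -> measurable_fun setT h ->
  (\int[leb]_u ((pos u * below s (tau (u, w)))%:E * h u) =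
   \int[leb]_(u in `[0%R, fine (inv s w)]) h u)%E.
Proof.
move=> s0 invy mh.
have invE : inv s w = (fine (inv s w))%:E.
  by rewrite fineK// ge0_fin_numE// inverse_subordinator_ge0.
rewrite [RHS]integral_mkcond epatch_indic; apply: ae_eq_integral => //.
- apply: emeasurable_funM => //; apply/measurable_EFinP.
  apply: measurable_funM; first exact: measurable_indic.
  by apply: (measurableT_comp (mbelow s)); exact: measurable_fun_pair.
- apply: emeasurable_funM => //; apply/measurable_EFinP; exact: measurable_indic.
- exists [set fine (inv s w)]; split => //; first exact: lebesgue_measure_set1.
  apply: subsetCl => u /= uL _.
  rewrite /= muleC; congr (_ * _%:E)%E.
  rewrite indic_itvcy indic_itvNyc indicE mem_setE in_itv/=.
  have [u0|] := leP 0 u; last by rewrite mul0r.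
  rewrite mul1r/= extended_pathE//; congr (nat_of_bool _)%:R.
  apply/idP/idP => [|uL'].
    by move=> /(inverse_subordinator_lb T_nd u0); rewrite invE lee_fin.
  rewrite leNgt; apply/negP => sT.
  have u1 : 0 < u.
    rewrite lt_neqAle u0 andbT; apply/eqP => u00.
    by move: sT; rewrite -u00 T_start ltNge s0.
  have := inverse_subordinator_le u1 sT; rewrite invE lee_fin => Lu.
  by apply: uL; apply/eqP; rewrite eq_le uL' Lu.
Qed.

End renewal.

Section renewal_identity.
Context {R : realType} {dO : measure_display} {Om : measurableType dO}.
Variables (P : probability Om R) (T : R -> Om -> R).
Hypothesis hT : subordinator P T.

Local Notation inv := (inverse_subordinator T).
Local Notation tau := (extended_path T).
Local Notation leb := (@lebesgue_measure R).
Local Notation pos := (\1_(`[0, +oo[%classic) : R -> R).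
Local Notation below s := (\1_(`]-oo, s]%classic) : R -> R).

Let T_nd := @sub_nondecreasing _ _ _ _ _ hT.
Let T_start := @sub_start _ _ _ _ _ hT.

Let mtau := measurable_path hT.

Let mbelow := measurable_below_level hT.

(** [expR (l * L s) = 1 + \int_0^(L s) l * expR (l * u) du], multiplied by
    [expR (- l * L t)]. *)
Lemma exp_inverse_increment l s t w : 0 < l -> 0 <= s -> s <= t ->
  (inv t w < +oo)%E ->
  ((expR (- l * (fine (inv t w) - fine (inv s w))))%:E =
   (expR (- l * fine (inv t w)))%:E +
   \int[leb]_u ((pos u * below s (tau (u, w)))%:E *
                (l * expR (- l * (fine (inv t w) - u)))%:E))%E.
Proof.
move=> l0 s0 st invty; have invsy : (inv s w < +oo)%E.
  exact: le_lt_trans (le_inverse_subordinator T w st) invty.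
rewrite (@occupation_integral _ _ _ _ _ hT _ _
  (fun u => (l * expR (- l * (fine (inv t w) - u)))%:E) s0 invsy).
  rewrite integral_exp_shift// ?fine_inverse_ge0//.
  by rewrite -EFinD [X in _ = X%:E]addrC subrK.
apply/measurable_EFinP; apply: measurable_funM => //.
apply: measurableT_comp => //; apply: measurable_funM => //.
exact: measurable_funB.
Qed.

Let mD : measurable (`[0, +oo[%classic `*` [set: Om] : set (R * Om)).
Proof. by apply: measurableX => //; exact: measurable_itv. Qed.

(** The renewal measure is the image by the path of the product of the Lebesgue
    measure on nonnegative times with the probability; this makes it a measure. *)
Let renewal_pushforward A : measurable A ->
  renewal P T A = pushforward (mrestr (leb \x P)%E mD) tau A.
Proof.
move=> mA; rewrite /pushforward /mrestr /renewal /product_measure1/=.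
rewrite integral_mkcond epatch_indic; apply: eq_integral => u _ /=.
rewrite indic_itvcy; case: leP => u0.
  rewrite mule1; congr (P _); apply/seteqP; split => w /=.
    by move=> Aw; rewrite /xsection/= inE/= extended_pathE//= in_itv/= u0.
  by rewrite /xsection/= inE/= extended_pathE//= => -[].
rewrite mule0 (_ : xsection _ _ = set0) ?measure0//.
apply/seteqP; split => w //=; rewrite /xsection/= inE/= in_itv/=.
by rewrite leNgt u0 => -[_ []].
Qed.

Lemma renewal_measure : exists M : {measure set R -> \bar R},
  forall A, measurable A -> renewal P T A = M A.
Proof.
unshelve eexists.
  by refine (pushforward (mrestr (leb \x P)%E mD) tau); exact: mtau.
exact: renewal_pushforward.
Qed.

Lemma integral_renewal s (f : R -> \bar R) :
  measurable_fun setT f -> (forall r, 0 <= f r)%E ->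
  (\int[renewal P T]_(r in `[0%R, s]) f r =
   \int[leb]_u ((pos u)%:E *
                \int[P]_w ((below s (T u w))%:E * f (T u w))))%E.
Proof.
move=> mf f0; rewrite (eq_integral_set_function _ _ renewal_pushforward).
rewrite ge0_integral_pushforward//; last exact: measurable_funTS.
pose g (p : R * Om) := ((pos p.1 * below s (tau p))%:E * f (tau p))%E.
have mg : measurable_fun setT g.
  apply: emeasurable_funM; last exact: measurableT_comp.
  apply/measurable_EFinP; apply: measurable_funM => //.
  by apply: measurableT_comp => //; exact: measurable_indic.
have g0 p : (0 <= g p)%E by rewrite mule_ge0// lee_fin mulr_ge0// indicE.
rewrite integral_mkcond ge0_integral_mrestr; last 2 first.
- apply/(measurable_restrictT _ _).1.
    by rewrite -[X in measurable X]setTI; exact: mtau.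
  by apply: measurable_funTS; exact: measurableT_comp.
- by move=> p; rewrite patchE; case: ifP => // _; exact: f0.
transitivity (\int[leb \x P]_p g p)%E.
  rewrite integral_mkcond; apply: eq_integral => -[u w] _.
  rewrite !patchE /g indic_itvcy indic_itvNyc.
  case: ifPn; last first.
    move=> /negP uD; case: leP => [u0|_]; last by rewrite mul0r mul0e.
    by exfalso; apply: uD; rewrite inE/= in_itv/= u0.
  rewrite inE/= in_itv/= andbT => -[u0 _]; rewrite u0 mul1r.
  case: ifPn => [|/negP Tus].
    by rewrite inE/= in_itv/= => /andP[_ ->]; rewrite mul1e.
  case: leP => [Tus'|_]; last by rewrite mul0e.
  exfalso; apply: Tus; rewrite inE/= in_itv/= Tus' andbT extended_pathE//.
  by rewrite -(T_start w) T_nd.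
rewrite fubini_tonelli1//; apply: eq_integral => u _.
rewrite /fubini_F /g/= indic_itvcy; case: leP => [u0|_].
  rewrite mul1e; apply: eq_integral => w _.
  by rewrite mul1r extended_pathE.
by rewrite mul0e integral0_eq// => w _; rewrite mul0r mul0e.
Qed.

End renewal_identity.

(** * The renewal identity *)

Section mean_laplace_theory.
Context {R : realType} {dO : measure_display} {Om : measurableType dO}.
Variables (P : probability Om R) (T : R -> Om -> R).
Hypothesis hT : subordinator P T.
Hypothesis hfin : forall t : R, 0 <= t ->
  P [set w | (inverse_subordinator T t w < +oo)%E] = 1%E.

Local Notation inv := (inverse_subordinator T).
Local Notation tau := (extended_path T).
Local Notation leb := (@lebesgue_measure R).
Local Notation pos := (\1_(`[0, +oo[%classic) : R -> R).
Local Notation below s := (\1_(`]-oo, s]%classic) : R -> R).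

Let mT := @sub_measurable _ _ _ _ _ hT.

Let mtau := measurable_path hT.

Let mbelow := measurable_below_level hT.

Lemma inverse_ae_finiteT t : {ae P, forall w, (inv t w < +oo)%E}.
Proof.
have m0 : 0 <= Num.max t 0 by rewrite le_max lexx orbT.
apply: filterS (inverse_ae_finite hT hfin m0) => w; apply: le_lt_trans.
by apply: le_inverse_subordinator; rewrite le_max lexx.
Qed.

Lemma le_fine_inverse s t w : s <= t -> (inv t w < +oo)%E ->
  fine (inv s w) <= fine (inv t w).
Proof.
move=> st ity; have st' := le_inverse_subordinator T w st.
by rewrite fine_le// ge0_fin_numE ?inverse_subordinator_ge0// (le_lt_trans st').
Qed.

Let mexp l t : measurable_fun setT (fun w => (expR (- l * fine (inv t w)))%:E).
Proof.
apply/measurable_EFinP.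
apply: (eq_measurable_fun (fun w => expR (- l * (fine (inv t w) - 0)))).
  by move=> w _; rewrite subr0.
exact: (measurable_inverse_exp hT).
Qed.

Lemma inverse_laplace_nonincreasing l s t : 0 <= l -> s <= t ->
  inverse_laplace P T t l <= inverse_laplace P T s l.
Proof.
move=> l0 st; rewrite -lee_fin -(mean_laplaceE hT t l0) -(mean_laplaceE hT s l0).
apply: ae_ge0_le_integral => //.
apply: filterS (inverse_ae_finiteT t) => w ity _.
rewrite lee_fin ler_expR !mulNr lerN2; apply: ler_wpM2l => //.
exact: le_fine_inverse.
Qed.

Lemma inverse_laplace_gt0 l t : 0 <= l -> 0 < inverse_laplace P T t l.
Proof.
move=> l0; rewrite -lte_fin -(mean_laplaceE hT)// lt0e mean_laplace_ge0 andbT.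
apply/eqP => e0.
have : ae_eq P setT (fun w => (expR (- l * fine (inv t w)))%:E) (cst 0%E).
  apply/(ae_eq_integral_abs P measurableT (mexp l t)).1.
  rewrite -[RHS]e0; apply: eq_integral => w _.
  by rewrite gee0_abs// lee_fin expR_ge0.
move=> [A [mA PA sA]].
have PT0 : P setT = 0%E.
  rewrite -PA; congr (P _); apply/seteqP; split=> // w _; apply: sA => /=.
  by move=> /(_ I) [] /eqP; rewrite gt_eqF// expR_gt0.
have := @probability_setT _ _ _ P; rewrite PT0 => /esym/eqP.
by rewrite onee_eq0.
Qed.

Lemma inverse_laplace0 t : inverse_laplace P T t 0 = 1.
Proof.
rewrite (inverse_laplaceE hT) /mean_laplace.
under eq_integral do rewrite oppr0 mul0r expR0.
rewrite integral_cst// mul1e.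
by transitivity (fine (1%E : \bar R)) => //; congr fine; exact: probability_setT.
Qed.

Let minv_laplace (l t : R) : 0 <= l ->
  measurable_fun setT (fun r : R => (inverse_laplace P T (t - r) l)%:E).
Proof.
move=> l0; apply/measurable_EFinP; apply: nondecreasing_measurable => // r r' rr.
by apply: inverse_laplace_nonincreasing => //; rewrite lerB.
Qed.

(** The exponential moment of [L_t - L_s], computed by integrating the
    decomposition of its exponential along the path up to [L_s] and restarting
    the subordinator at each time [u < L_s]. *)
Lemma mean_exp_inverse_increment (l s t : R) : 0 < l -> 0 <= s -> s <= t ->
  (\int[P]_w (expR (- l * (fine (inv t w) - fine (inv s w))))%:E =
   (inverse_laplace P T t l)%:E + l%:E *
   \int[renewal P T]_(r in `[0%R, s]) (inverse_laplace P T (t - r) l)%:E)%E.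
Proof.
move=> l0 s0 st; have t0 : 0 <= t by exact: le_trans st.
pose K (p : Om * measurableTypeR R) : \bar R :=
  ((pos p.2 * below s (tau (p.2, p.1)))%:E *
   (l * expR (- l * (fine (inv t p.1) - p.2)))%:E)%E.
have K0 p : (0 <= K p)%E.
  by rewrite mule_ge0// lee_fin ?mulr_ge0 ?expR_ge0 ?ltW// indicE.
have msw : measurable_fun setT (fun p : Om * measurableTypeR R => (p.2, p.1)).
  exact: measurable_fun_pair.
have mK : measurable_fun setT K.
  apply: emeasurable_funM; apply/measurable_EFinP; apply: measurable_funM => //.
  - by apply: measurableT_comp => //; exact: measurable_indic.
  - exact: (measurableT_comp (mbelow s) msw).
  - apply: measurableT_comp => //; apply: measurable_funM => //.
    apply: measurable_funB => //; apply: measurableT_comp => //.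
    apply: measurableT_comp => //.
    exact: (measurable_inverse_subordinator (sub_nondecreasing hT)).
transitivity (\int[P]_w ((expR (- l * fine (inv t w)))%:E +
                         \int[leb]_u K (w, u)))%E.
  apply: ae_eq_integral => //.
  - apply/measurable_EFinP; apply: measurableT_comp => //.
    apply: measurable_funM => //.
    by apply: measurable_funB; exact: (measurable_fine_inverse hT).
  - apply: emeasurable_funD; first exact: mexp.
    exact: (measurable_fun_fubini_tonelli_F _ mK K0).
  - apply: filterS (inverse_ae_finiteT t) => w ity _.
    exact: (exp_inverse_increment hT).
rewrite ge0_integralD//; last 2 first.
- by move=> w _; exact: integral_ge0.
- exact: (measurable_fun_fubini_tonelli_F _ mK K0).
rewrite -/(mean_laplace P T l t) (mean_laplaceE hT _ (ltW l0)); congr (_ + _)%E.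
rewrite (fubini_tonelli K mK K0) (integral_renewal hT)//; last 2 first.
- by apply: minv_laplace; exact: ltW.
- by move=> r; rewrite lee_fin ltW// inverse_laplace_gt0// ltW.
pose Q (u : measurableTypeR R) : \bar R := (\int[P]_w
  ((pos u * below s (tau (u, w)))%:E * (inverse_laplace P T (t - tau (u, w)) l)%:E))%E.
have Q0 u : (0 <= Q u)%E.
  apply: integral_ge0 => w _; rewrite -EFinM lee_fin; apply: mulr_ge0.
    by rewrite !indicE mulr_ge0.
  by rewrite ltW// inverse_laplace_gt0// ltW.
have mQ : measurable_fun setT Q.
  pose g (p : measurableTypeR R * Om) := ((pos p.1 * below s (tau p))%:E *
     (inverse_laplace P T (t - tau p) l)%:E)%E.
  apply: (measurable_fun_fubini_tonelli_F (m2 := P) g).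
    apply: emeasurable_funM.
      apply/measurable_EFinP; apply: measurable_funM; last exact: mbelow.
      by apply: measurableT_comp => //; exact: measurable_indic.
    have mc := measurableT_comp (minv_laplace t (ltW l0)) mtau.
    exact: mc.
  move=> p; rewrite /g -EFinM lee_fin; apply: mulr_ge0.
    by rewrite !indicE mulr_ge0.
  by rewrite ltW// inverse_laplace_gt0// ltW.
transitivity (\int[leb]_u (l%:E * Q u))%E.
  apply: eq_integral => u _; rewrite /K/= /Q indic_itvcy.
  case: (leP 0 u) => u0; last first.
    rewrite !integral0_eq ?mule0// => w _; by rewrite mul0r mul0e.
  under eq_integral do rewrite mul1r extended_pathE//.
  under [in RHS]eq_integral do rewrite mul1r extended_pathE//.
  transitivity (\int[P]_w (l%:E * (below s (T u w) *
      expR (- l * (fine (inv t w) - u)))%:E))%E.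
    by apply: eq_integral => w _; rewrite -!EFinM; congr EFin; ring.
  rewrite ge0_integralZl//; last 2 first.
  - apply/measurable_EFinP; apply: measurable_funM.
      by apply: measurableT_comp; [exact: measurable_indic|exact: mT].
    exact: (measurable_inverse_exp hT).
  - by rewrite lee_fin ltW.
  rewrite (mean_laplace_shift hT hfin l0)//; congr (_ * _)%E.
  by apply: eq_integral => w _; rewrite (mean_laplaceE hT _ (ltW l0)).
have l0E : (0 <= l%:E)%E by rewrite lee_fin ltW.
transitivity (l%:E * \int[leb]_u Q u)%E.
  exact: (ge0_integralZl leb measurableT mQ (fun u _ => Q0 u) l0E).
congr (_ * _)%E.
apply: eq_integral => u _; rewrite /Q indic_itvcy; case: (leP 0 u) => u0.
  by rewrite mul1e; apply: eq_integral => w _; rewrite mul1r extended_pathE.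
by rewrite mul0e integral0_eq// => w _; rewrite mul0r mul0e.
Qed.

End mean_laplace_theory.

Section renewal_integral_theory.
Context {R : realType} {dO : measure_display} {Om : measurableType dO}.
Variables (P : probability Om R) (T : R -> Om -> R).
Hypothesis hT : subordinator P T.
Hypothesis hfin : forall t : R, 0 <= t ->
  P [set w | (inverse_subordinator T t w < +oo)%E] = 1%E.

Local Notation inv := (inverse_subordinator T).
Local Notation tau := (extended_path T).
Local Notation leb := (@lebesgue_measure R).
Local Notation eta := (inverse_laplace P T).

Lemma integral_inverse_subordinator (s : R) : 0 <= s ->
  (\int[P]_w (fine (inv s w))%:E = renewal P T `[0%R, s]%classic)%E.
Proof.
move=> s0.
have [M rM] := renewal_measure hT; rewrite rM; last exact: measurable_itv.
transitivity (\int[renewal P T]_(r in `[0%R, s]) (cst 1 r))%E; last first.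
  rewrite (eq_integral_set_function _ _ rM).
  by rewrite integral_cst ?mul1e//; exact: measurable_itv.
rewrite (integral_renewal hT)//.
pose g (p : Om * measurableTypeR R) : \bar R :=
  ((\1_(`[0, +oo[%classic) p.2 * \1_(`]-oo, s]%classic) (tau (p.2, p.1)))%:E * 1)%E.
have g0 p : (0 <= g p)%E by rewrite /g mule1 lee_fin mulr_ge0// indicE.
have mg : measurable_fun setT g.
  apply: emeasurable_funM => //; apply/measurable_EFinP; apply: measurable_funM.
    by apply: measurableT_comp => //; exact: measurable_indic.
  apply: measurableT_comp; first exact: measurable_indic.
  apply: (measurableT_comp (measurable_extended_path (sub_nondecreasing hT)
    (sub_right_continuous hT) (sub_measurable hT))) => /=.
  exact: measurable_fun_pair.
transitivity (\int[P]_w \int[leb]_u g (w, u))%E.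
  apply: ae_eq_integral => //.
  - by apply/measurable_EFinP; exact: (measurable_fine_inverse hT).
  - exact: (measurable_fun_fubini_tonelli_F _ mg g0).
  - apply: filterS (inverse_ae_finite hT hfin s0) => w isy _.
    rewrite (occupation_integral hT (h := cst 1%E))//.
    rewrite integral_cst//= mul1e lebesgue_measure_itv/= lte_fin.
    have := fine_inverse_ge0 T s w.
    rewrite le_eqVlt => /predU1P[<-|L0]; first by rewrite ltxx.
    by rewrite L0 -EFinD subr0.
rewrite (fubini_tonelli g mg g0); apply: eq_integral => u _; rewrite /g/=.
have [u0|u0] := leP 0 u; last first.
  rewrite [X in (X%:E * _)%E]indicE mem_setE in_itv/= leNgt u0 mul0e.
  by rewrite integral0_eq// => w _; rewrite indicE mem_setE in_itv/= leNgt u0 mul0r mul0e.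
rewrite [X in (X%:E * _)%E]indicE mem_setE in_itv/= u0 mul1e.
apply: eq_integral => w _; rewrite indicE mem_setE in_itv/= u0 mul1r.
by rewrite /extended_path/= max_l.
Qed.

(** The mean of [expR (- l * (L t - L s))] is at most [1], and the renewal identity
    bounds the renewal integral by it. *)
Lemma renewal_integral_fin (l s t : R) : 0 < l -> 0 <= s -> s <= t ->
  (\int[renewal P T]_(r in `[0%R, s]) (eta (t - r) l)%:E)%E \is a fin_num.
Proof.
move=> l0 s0 st; have := mean_exp_inverse_increment hT hfin l0 s0 st.
set W := (\int[renewal P T]_(r in _) _)%E => AE.
have [M rM] := renewal_measure hT.
have W0 : (0 <= W)%E.
  rewrite /W (eq_integral_set_function _ _ rM); apply: integral_ge0 => r _.
  by rewrite lee_fin ltW// (inverse_laplace_gt0 hT)// ltW.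
have A1 : (\int[P]_w (expR (- l * (fine (inv t w) - fine (inv s w))))%:E <= 1)%E.
  rewrite -(@probability_setT _ _ _ P) -[leRHS]mul1e -integral_cst//.
  apply: ae_ge0_le_integral => //.
  - apply/measurable_EFinP; apply: measurableT_comp => //.
    apply: measurable_funM => //.
    by apply: measurable_funB; exact: (measurable_fine_inverse hT).
  - apply: filterS (inverse_ae_finiteT hT hfin t) => w ity _.
    rewrite lee_fin -expR0 ler_expR mulNr oppr_le0.
    apply: mulr_ge0; first exact: ltW.
    by rewrite subr_ge0; exact: le_fine_inverse.
rewrite ge0_fin_numE// ltNge leye_eq; apply/eqP => Wy.
by move: A1; rewrite AE Wy gt0_muley ?lte_fin// addey// leye_eq.
Qed.

Lemma renewal_identity (l s t : R) : 0 <= l -> 0 <= s -> s <= t ->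
  \int[P]_w expR (- l * (fine (inv t w) - fine (inv s w))) =
  l * renewal_integral P T s (fun r => eta (t - r) l) + eta t l.
Proof.
rewrite le_eqVlt => /predU1P[<-|l0] s0 st.
  rewrite mul0r add0r (inverse_laplace0 hT) /Rintegral.
  under eq_integral do rewrite oppr0 mul0r expR0.
  rewrite integral_cst// mul1e.
  by transitivity (fine (1%E : \bar R)) => //; congr fine; exact: probability_setT.
rewrite /Rintegral (mean_exp_inverse_increment hT hfin)// /renewal_integral.
have Wfin := renewal_integral_fin l0 s0 st.
by rewrite -(fineK Wfin) -EFinM -EFinD/= addrC.
Qed.

Let eta_bounds (l s t : R) (M : {measure set R -> \bar R}) : 0 <= l ->
  ((eta t l)%:E * M `[0%R, s]%classic <=
   \int[M]_(r in `[0%R, s]) (eta (t - r) l)%:E)%E /\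
  (\int[M]_(r in `[0%R, s]) (eta (t - r) l)%:E <=
   (eta (t - s) l)%:E * M `[0%R, s]%classic)%E.
Proof.
move=> l0; have mI : measurable (`[0%R, s]%classic : set R) by exact: measurable_itv.
have meta : measurable_fun (`[0%R, s]%classic : set R) (fun r : R => (eta (t - r) l)%:E).
  apply/measurable_EFinP; apply: nondecreasing_measurable => // r r' rr.
  by apply: (inverse_laplace_nonincreasing hT hfin) => //; rewrite lerB.
have eta0 r : (0 <= (eta r l)%:E)%E.
  by rewrite lee_fin ltW// (inverse_laplace_gt0 hT).
split.
  rewrite -(integral_cst M mI); apply: ge0_le_integral; first exact: mI.
  - by move=> r _; exact: eta0.
  - exact: measurable_cst.
  - exact: meta.
  move=> r; rewrite /= in_itv/= => /andP[r0 rs]; rewrite lee_fin.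
  by apply: (inverse_laplace_nonincreasing hT hfin) => //; rewrite gerBl.
rewrite -(integral_cst M mI); apply: ge0_le_integral; first exact: mI.
- by move=> r _; exact: eta0.
- exact: meta.
- exact: measurable_cst.
move=> r; rewrite /= in_itv/= => /andP[r0 rs]; rewrite lee_fin.
by apply: (inverse_laplace_nonincreasing hT hfin) => //; rewrite lerB.
Qed.

(** [eta] is nonincreasing and the renewal mass of [[0, s]] is the mean of [L s].
    That this mean is finite comes from the lower bound itself, as [eta t] is
    positive. *)
Lemma renewal_integral_bounds (l s t : R) : 0 < l -> 0 <= s -> s <= t ->
  eta t l * mean_inverse P T s <= renewal_integral P T s (fun r => eta (t - r) l) /\
  renewal_integral P T s (fun r => eta (t - r) l) <= eta (t - s) l * mean_inverse P T s.
Proof.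
move=> l0 s0 st; have Wfin := renewal_integral_fin l0 s0 st.
have [M rM] := renewal_measure hT.
have ME : M `[0%R, s]%classic = (\int[P]_w (fine (inv s w))%:E)%E.
  by rewrite integral_inverse_subordinator// rM//; exact: measurable_itv.
rewrite /renewal_integral /mean_inverse /Rintegral -ME.
move: Wfin; rewrite (eq_integral_set_function _ _ rM) => Wfin.
have [lb ub] := @eta_bounds l s t M (ltW l0).
have Mfin : M `[0%R, s]%classic \is a fin_num.
  rewrite ge0_fin_numE// ltNge leye_eq; apply/eqP => My.
  move: lb; rewrite My gt0_muley ?leye_eq; last first.
    by rewrite lte_fin (inverse_laplace_gt0 hT)// ltW.
  by move=> /eqP Wy; rewrite Wy in Wfin.
by split; rewrite -lee_fin EFinM (fineK Mfin) (fineK Wfin).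
Qed.

End renewal_integral_theory.

(** * Stationarity of the Markov process *)

Section law_on_rectangles.
Local Open Scope ereal_scope.
Context {R : realType} {d1 d2 : measure_display}.
Context {T1 : measurableType d1} {T2 : measurableType d2}.

Lemma eq_measure_rectangles (m1 m2 : probability (T1 * T2)%type R) :
  (forall A B, measurable A -> measurable B -> m1 (A `*` B) = m2 (A `*` B)) ->
  forall C, measurable C -> m1 C = m2 C.
Proof.
move=> m12 C mC.
apply: (measure_unique [set A `*` B | A in measurable & B in measurable]
  (fun=> setT)) => //.
- by rewrite measurable_prod_measurableType.
- move=> _ _ [A mA [B mB <-]] [A' mA' [B' mB' <-]]; rewrite -setXI.
  exists (A `&` A'); first exact: measurableI.
  by exists (B `&` B') => //; exact: measurableI.
- by move=> _; exists setT => //; exists setT => //; rewrite setXTT.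
- by rewrite bigcup_const//; exists 0%N.
- by move=> _ [A mA [B mB <-]]; exact: m12.
- by move=> _; rewrite (le_lt_trans (probability_le1 _ measurableT)) ?ltry.
Qed.

End law_on_rectangles.

Section markov_pairs.
Context {R : realType} {dE dO : measure_display}.
Context {E : measurableType dE} {Omega : measurableType dO}.
Variables (Px : R.-pker E ~> Omega) (X : R -> Omega -> E).
Hypothesis hX : markov_process Px X.
Variable nu : probability E R.
Hypothesis hinv : invariant_measure Px X nu.

Local Notation Q := (Pinit Px nu).

Lemma measurable_markov t : 0 <= t -> measurable_fun setT (X t).
Proof. by have [mX _] := markov_measurable hX; exact: mX. Qed.

Let mXpre t (B : set E) : 0 <= t -> measurable B -> measurable (X t @^-1` B).
Proof. by move=> t0 mB; rewrite -[X in measurable X]setTI; exact: measurable_markov. Qed.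

Let pker_fin x (A : set Omega) : measurable A -> Px x A \is a fin_num.
Proof.
move=> mA; rewrite ge0_fin_numE// (@le_lt_trans _ _ (Px x setT))//.
  by apply: le_measure; rewrite ?inE.
by rewrite prob_kernel ltry.
Qed.

Let kern h B y : \bar R := Px y (X h @^-1` B).

Let mkern h B : 0 <= h -> measurable B -> measurable_fun setT (kern h B).
Proof. by move=> h0 mB; apply: measurable_kernel; exact: mXpre. Qed.

Let semigroup_indic h B y : 0 <= h -> measurable B ->
  (semigroup Px X h \1_B y)%:E = kern h B y.
Proof.
move=> h0 mB; rewrite /semigroup /Rintegral.
rewrite (eq_integral (fun w => (\1_(X h @^-1` B) w)%:E)); last first.
  by move=> w _; rewrite !indicE.
rewrite integral_indic ?setIT//; last exact: mXpre.
by rewrite fineK// pker_fin//; exact: mXpre.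
Qed.

Let indic_bounded (B : set E) : measurable B -> bounded_measurable (\1_B : E -> R).
Proof.
move=> mB; split; first exact: measurable_indic.
by exists 1 => x; rewrite indicE; case: (_ \in _); rewrite ?normr1 ?normr0.
Qed.

Lemma law_markov t B : 0 <= t -> measurable B -> Q (X t @^-1` B) = nu B.
Proof.
move=> t0 mB.
have := hinv t0 (indic_bounded mB).
rewrite /Rintegral.
under eq_integral do rewrite semigroup_indic//.
rewrite integral_indic// setIT => fE.
rewrite -[LHS]fineK; last by rewrite fin_num_measure//; exact: mXpre.
by rewrite fE fineK// fin_num_measure.
Qed.

(* the Markov property on a rectangle, freed from real-valued integrals *)
Let pair_kernel x s h A B : 0 <= s -> 0 <= h -> measurable A -> measurable B ->
  (Px x (X s @^-1` A `&` X (s + h) @^-1` B) =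
   \int[Px x]_w ((\1_A (X s w))%:E * kern h B (X s w)))%E.
Proof.
move=> s0 h0 mA mB.
have hist : history `[0, s]%classic X (X s @^-1` A).
  apply: sub_gen_smallest; exists s, A; split => //.
  by rewrite /= in_itv/= s0 lexx.
have := markov_property hX x s0 h0 (indic_bounded mB) hist.
rewrite /Rintegral.
rewrite (eq_integral (fun w => (\1_(X (s + h) @^-1` B) w)%:E)); last first.
  by move=> w _; rewrite !indicE.
rewrite integral_indic; [|exact: mXpre|by apply: mXpre => //; exact: addr_ge0].
under [in RHS]eq_integral do rewrite semigroup_indic//.
rewrite setIC [in RHS]integral_mkcond epatch_indic => fE.
have mAB : measurable (X s @^-1` A `&` X (s + h) @^-1` B).
  by apply: measurableI; apply: mXpre => //; exact: addr_ge0.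
have kE : (\int[Px x]_w (kern h B (X s w) * (\1_(X s @^-1` A) w)%:E) =
    \int[Px x]_w ((\1_A (X s w))%:E * kern h B (X s w)))%E.
  by apply: eq_integral => w _; rewrite muleC !indicE.
rewrite -kE -[LHS]fineK ?pker_fin// fE fineK// ge0_fin_numE; last first.
  by apply: integral_ge0 => w _; rewrite mule_ge0// lee_fin indicE.
rewrite (@le_lt_trans _ _ (\int[Px x]_w (cst 1%E w))%E)//; last first.
  by rewrite integral_cst// mul1e prob_kernel ltry.
apply: ge0_le_integral => //.
- by move=> w _; rewrite mule_ge0// lee_fin indicE.
- apply: emeasurable_funM.
    by apply: measurableT_comp; [exact: mkern|exact: measurable_markov].
  by apply/measurable_EFinP; apply: measurable_indic; exact: mXpre.
- move=> w _; rewrite -[leRHS]mule1; apply: lee_pmul => //.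
  + by rewrite lee_fin indicE.
  + rewrite /kern -[leRHS](prob_kernel (s := Px) (X s w)).
    by apply: le_measure; rewrite ?inE//; exact: mXpre.
  + by rewrite lee_fin indicE; case: (_ \in _).
Qed.

(** The value does not depend on [s]: the pair [(X s, X (s + h))] is
    stationary under the invariant initial law. *)
Let pair_rectangle s h A B : 0 <= s -> 0 <= h -> measurable A -> measurable B ->
  (Q (X s @^-1` A `&` X (s + h) @^-1` B) =
   \int[nu]_x ((\1_A x)%:E * kern h B x))%E.
Proof.
move=> s0 h0 mA mB.
have mG : measurable_fun setT (fun y => ((\1_A y)%:E * kern h B y)%E).
  apply: emeasurable_funM; last exact: mkern.
  by apply/measurable_EFinP; exact: measurable_indic.
have G0 y : (0 <= (\1_A y)%:E * kern h B y)%E.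
  by rewrite mule_ge0// lee_fin indicE.
transitivity (\int[Q]_w ((\1_A (X s w))%:E * kern h B (X s w)))%E.
  rewrite ge0_integral_Pinit//; last first.
    by apply: (measurableT_comp mG); exact: measurable_markov.
  by apply: eq_integral => x _; exact: pair_kernel.
transitivity (\int[pushforward Q (X s)]_y ((\1_A y)%:E * kern h B y))%E.
  by rewrite ge0_integral_pushforward//; exact: measurable_markov.
by apply: eq_integral_set_function => C mC; exact: law_markov.
Qed.

Let W s h w := (X s w, X (s + h) w).

Lemma stationary_pair s h C : 0 <= s -> 0 <= h -> measurable C ->
  Q ((fun w => (X s w, X (s + h) w)) @^-1` C) =
  Q ((fun w => (X 0 w, X h w)) @^-1` C).
Proof.
move=> s0 h0 mC.
have mW u : 0 <= u -> measurable_fun setT (W u h).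
  move=> u0; apply: measurable_fun_pair; apply: measurable_markov => //.
  exact: addr_ge0.
pose Ws : {mfun Omega >-> (E * E)%type} := mfun_Sub (mem_set (mW s s0)).
pose W0 : {mfun Omega >-> (E * E)%type} := mfun_Sub (mem_set (mW 0 (lexx 0))).
have := @eq_measure_rectangles _ _ _ _ _ (distribution Q Ws) (distribution Q W0).
rewrite /distribution /pushforward /W0 /Ws /= /W => eqW.
have -> : (fun w => (X 0 w, X h w)) = (fun w => (X 0 w, X (0 + h) w)).
  by rewrite add0r.
apply: eqW => // A B mA mB.
rewrite [LHS](pair_rectangle s0 h0 mA mB).
by rewrite [RHS](pair_rectangle (lexx 0) h0 mA mB).
Qed.

End markov_pairs.

(** * Eigenfunctions at two deterministic times *)

Section square_integrable.
Context {R : realType} {d : measure_display} {T : measurableType d}.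

Lemma integral_eq_law {d' : measure_display} {S : measurableType d'}
    (P : probability T R) (Y Y' : T -> S) (G : S -> \bar R) :
  measurable_fun setT Y -> measurable_fun setT Y' ->
  (forall B, measurable B -> P (Y @^-1` B) = P (Y' @^-1` B)) ->
  measurable_fun setT G ->
  (\int[P]_w G (Y w) = \int[P]_w G (Y' w))%E.
Proof.
move=> mY mY' YY' mG; rewrite integralE [RHS]integralE; congr (_ - _)%E.
- rewrite (_ : (fun w => G (Y w))^\+ = G^\+ \o Y)%E; last exact: funepos_comp.
  rewrite (_ : (fun w => G (Y' w))^\+ = G^\+ \o Y')%E; last exact: funepos_comp.
  apply: (@ge0_integral_eq_law _ _ _ _ _ P Y Y' G^\+%E) => //.
  exact: measurable_funepos.
- rewrite (_ : (fun w => G (Y w))^\- = G^\- \o Y)%E; last exact: funeneg_comp.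
  rewrite (_ : (fun w => G (Y' w))^\- = G^\- \o Y')%E; last exact: funeneg_comp.
  apply: (@ge0_integral_eq_law _ _ _ _ _ P Y Y' G^\-%E) => //.
  exact: measurable_funeneg.
Qed.

Lemma integrable_mul (mu : {measure set T -> \bar R}) (a b : T -> R) :
  measurable_fun setT a -> measurable_fun setT b ->
  mu.-integrable setT (fun w => (a w ^+ 2)%:E) ->
  mu.-integrable setT (fun w => (b w ^+ 2)%:E) ->
  mu.-integrable setT (fun w => (a w * b w)%:E).
Proof.
move=> ma mb ia ib.
apply: (@le_integrable _ _ _ _ _ measurableT _
  (fun w => ((a w ^+ 2)%:E + (b w ^+ 2)%:E)%E)); last exact: integrableD.
- by apply/measurable_EFinP; exact: measurable_funM.
- move=> w _; rewrite -EFinD /= lee_fin.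
  rewrite [leRHS]ger0_norm ?addr_ge0 ?sqr_ge0// ler_norml.
  by apply/andP; split; nra.
Qed.

Lemma Lfun_measurable (mu : {measure set T -> \bar R}) p (f : T -> R) :
  f \in Lfun mu p -> measurable_fun setT f.
Proof. by move=> /sub_Lfun_mfun /set_mem. Qed.

Lemma Lfun2_integrable (mu : probability T R) (f g : T -> R) :
  f \in Lfun mu 2%:E -> g \in Lfun mu 2%:E ->
  mu.-integrable setT (fun x => (f x * g x)%:E).
Proof.
move=> Lf Lg; apply: integrable_mul; [exact: Lfun_measurable Lf|
  exact: Lfun_measurable Lg| |]; exact: Lfun2_integrable_sqr.
Qed.

Lemma innerE (mu : probability T R) (f g : T -> R) :
  f \in Lfun mu 2%:E -> g \in Lfun mu 2%:E ->
  (\int[mu]_x (f x * g x)%:E)%E = (inner mu f g)%:E.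
Proof.
move=> Lf Lg; rewrite /inner /Rintegral fineK//.
by apply: integrable_fin_num => //; exact: Lfun2_integrable.
Qed.

Lemma inner_ae_eq (mu : probability T R) (f f' g : T -> R) :
  measurable_fun setT f -> measurable_fun setT f' -> measurable_fun setT g ->
  ae_eq mu setT f f' -> inner mu f g = inner mu f' g.
Proof.
move=> mf mf' mg ff'; rewrite /inner /Rintegral; congr fine.
apply: ae_eq_integral => //.
- by apply/measurable_EFinP; exact: measurable_funM.
- by apply/measurable_EFinP; exact: measurable_funM.
- by apply: filterS ff' => x /(_ I) -> _.
Qed.

Lemma innerC (mu : probability T R) (f g : T -> R) : inner mu f g = inner mu g f.
Proof. by apply: eq_Rintegral => x _; rewrite mulrC. Qed.

Lemma innerZl (mu : probability T R) c (f g : T -> R) :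
  f \in Lfun mu 2%:E -> g \in Lfun mu 2%:E ->
  inner mu (fun x => c * f x) g = c * inner mu f g.
Proof.
move=> Lf Lg; rewrite /inner -RintegralZl//; last exact: Lfun2_integrable.
by apply: eq_Rintegral => x _; rewrite mulrA.
Qed.

End square_integrable.

Section eigenfunctions.
Context {R : realType} {dE dO : measure_display}.
Context {E : measurableType dE} {Omega : measurableType dO}.
Variables (Px : R.-pker E ~> Omega) (X : R -> Omega -> E).
Hypothesis hX : markov_process Px X.
Variable nu : probability E R.
Hypothesis hinv : invariant_measure Px X nu.

Local Notation Q := (Pinit Px nu).
Local Notation L2 := (Lfun nu 2%:E).

Let mX t : 0 <= t -> measurable_fun setT (X t).
Proof. exact: (measurable_markov hX). Qed.

Lemma integral_markov t (F : E -> \bar R) : 0 <= t -> measurable_fun setT F ->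
  (\int[Q]_w F (X t w) = \int[nu]_x F x)%E.
Proof.
move=> t0 mF.
have ge0 (G : E -> \bar R) : measurable_fun setT G -> (forall x, 0 <= G x)%E ->
    (\int[Q]_w (G \o X t) w = \int[nu]_x G x)%E.
  move=> mG G0; transitivity (\int[pushforward Q (X t)]_y G y)%E.
    by rewrite ge0_integral_pushforward//; exact: mX.
  by apply: eq_integral_set_function => B mB; exact: (law_markov hX hinv).
rewrite integralE [RHS]integralE.
rewrite (_ : (fun w => F (X t w))^\+ = F^\+ \o X t)%E; last exact: funepos_comp.
rewrite (_ : (fun w => F (X t w))^\- = F^\- \o X t)%E; last exact: funeneg_comp.
by rewrite !ge0//; [exact: measurable_funeneg|exact: measurable_funepos].
Qed.

Lemma integrable_markov t (F : E -> \bar R) : 0 <= t ->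
  nu.-integrable setT F -> Q.-integrable setT (fun w => F (X t w)).
Proof.
move=> t0 /integrableP[mF iF]; apply/integrableP; split.
  by apply: (measurableT_comp mF); exact: mX.
by rewrite (integral_markov (F := abse \o F))//; exact: measurableT_comp.
Qed.

Lemma integrable_markov_mul u v f g : 0 <= u -> 0 <= v -> f \in L2 -> g \in L2 ->
  Q.-integrable setT (fun w => (f (X u w) * g (X v w))%:E).
Proof.
move=> u0 v0 Lf Lg.
apply: (@integrable_mul _ _ _ Q (f \o X u) (g \o X v)) => /=.
- by apply: measurableT_comp; [exact: Lfun_measurable Lf|exact: mX].
- by apply: measurableT_comp; [exact: Lfun_measurable Lg|exact: mX].
- exact: (integrable_markov u0 (Lfun2_integrable_sqr Lf)).
- exact: (integrable_markov v0 (Lfun2_integrable_sqr Lg)).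
Qed.

(** Under [Px x], [g (X 0)] is almost surely the constant [g x]: the singleton
    [[set x]] may fail to be measurable, but the level set of [g] through [x] is
    measurable. *)
Let integral_start f g h x : 0 <= h -> measurable_fun setT f ->
  measurable_fun setT g -> (Px x).-integrable setT (fun w => (f (X h w))%:E) ->
  (\int[Px x]_w (f (X h w) * g (X 0 w))%:E = (semigroup Px X h f x * g x)%:E)%E.
Proof.
move=> h0 mf mg iF.
have mfX : measurable_fun setT (fun w => f (X h w)).
  by apply: measurableT_comp => //; exact: mX.
transitivity (\int[Px x]_w ((f (X h w))%:E * (g x)%:E))%E.
  apply: ae_eq_integral => //.
  - apply/measurable_EFinP; apply: measurable_funM => //.
    by apply: measurableT_comp => //; exact: mX.
  - by apply: emeasurable_funM => //; exact/measurable_EFinP.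
  - have mA : measurable (~` (g @^-1` [set g x])).
      by apply: measurableC; rewrite -[X in measurable X]setTI; exact: mg.
    exists (X 0 @^-1` (~` (g @^-1` [set g x]))); split.
    + by rewrite -[X in measurable X]setTI; exact: mX.
    + by rewrite (markov_initial hX)// diracE memNset//=; exact.
    + by move=> w /= ne gw; apply: ne => _; rewrite gw EFinM.
rewrite integralZr// EFinM; congr (_ * _)%E.
by rewrite /semigroup /Rintegral fineK//; exact: integrable_fin_num.
Qed.

Lemma measurable_semigroup h f : 0 <= h -> measurable_fun setT f ->
  measurable_fun setT (semigroup Px X h f).
Proof.
move=> h0 mf; apply: measurableT_comp => //.
apply: measurable_integral_pker; apply/measurable_EFinP.
by apply: measurableT_comp => //; exact: mX.
Qed.

(** Stationarity moves the pair of times to [0] and [h], where conditioning on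
    the starting point makes the semigroup appear. *)
Lemma integral_two_times f g s h : 0 <= s -> 0 <= h -> f \in L2 -> g \in L2 ->
  (\int[Q]_w (f (X (s + h) w) * g (X s w))%:E =
   \int[nu]_x (semigroup Px X h f x * g x)%:E)%E.
Proof.
move=> s0 h0 Lf Lg.
have mf := Lfun_measurable Lf; have mg := Lfun_measurable Lg.
transitivity (\int[Q]_w (f (X h w) * g (X 0 w))%:E)%E.
  apply: (@integral_eq_law _ _ _ _ _ Q (fun w => (X s w, X (s + h) w))
    (fun w => (X 0 w, X h w)) (fun p => (f p.2 * g p.1)%:E)).
  - by apply: measurable_fun_pair; apply: mX => //; exact: addr_ge0.
  - by apply: measurable_fun_pair; apply: mX.
  - by move=> B mB; exact: (stationary_pair hX hinv).
  - apply/measurable_EFinP; apply: measurable_funM; exact: measurableT_comp.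
rewrite integral_Pinit; last exact: integrable_markov_mul.
apply: ae_eq_integral => //.
- apply: measurable_integral_pker; apply/measurable_EFinP.
  by apply: measurable_funM; apply: measurableT_comp => //; exact: mX.
- apply/measurable_EFinP; apply: measurable_funM => //.
  exact: measurable_semigroup.
- have iF : Q.-integrable setT (fun w => (f (X h w))%:E).
    apply: (@integrable_markov h (EFin \o f)) => //.
    apply/Lfun1_integrable; apply: Lfun_subset12 Lf.
    by rewrite fin_num_measure.
  apply: filterS (integrable_Pinit_ae iF) => x ix _.
  exact: integral_start.
Qed.

Definition eigenfunction (r : R) (f : E -> R) := forall h : R, 0 <= h ->
  ae_eq nu setT (semigroup Px X h f) (fun x => expR (- r * h) * f x).

Lemma integral_eigenfunction r f g u v : eigenfunction r f ->
  0 <= v -> v <= u -> f \in L2 -> g \in L2 ->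
  (\int[Q]_w (f (X u w) * g (X v w))%:E =
   (expR (- r * (u - v)) * inner nu f g)%:E)%E.
Proof.
move=> ef v0 vu Lf Lg; have uv0 : 0 <= u - v by rewrite subr_ge0.
have -> : u = v + (u - v) by rewrite addrC subrK.
rewrite integral_two_times// addrAC subrr add0r.
have mf := Lfun_measurable Lf; have mg := Lfun_measurable Lg.
transitivity (\int[nu]_x ((expR (- r * (u - v)))%:E * (f x * g x)%:E))%E.
  apply: ae_eq_integral => //.
  - apply/measurable_EFinP; apply: measurable_funM => //.
    exact: measurable_semigroup.
  - apply: emeasurable_funM => //; apply/measurable_EFinP; exact: measurable_funM.
  - by apply: filterS (ef _ uv0) => x /(_ I) -> _; rewrite -EFinM mulrA.
by rewrite integralZl ?innerE//; exact: Lfun2_integrable.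
Qed.

End eigenfunctions.

(** * Means and orthogonality *)

Section eigenfunction_theory.
Context {R : realType} {dE dO : measure_display}.
Context {E : measurableType dE} {Omega : measurableType dO}.
Variables (Px : R.-pker E ~> Omega) (X : R -> Omega -> E).
Hypothesis hX : markov_process Px X.
Variable nu : probability E R.
Hypothesis hinv : invariant_measure Px X nu.

Local Notation Q := (Pinit Px nu).
Local Notation L2 := (Lfun nu 2%:E).
Local Notation eig := (eigenfunction Px X nu).

Let cst1_L2 : (cst 1 : E -> R) \in L2.
Proof. exact: Lfun_cst. Qed.

Lemma inner_cst1 f : inner nu f (cst 1) = \int[nu]_x f x.
Proof. by apply: eq_Rintegral => x _; rewrite mulr1. Qed.

Let exp_neq1 (r : R) : r != 0 -> expR (- r) != 1.
Proof. by move=> r0; rewrite -expR0 (inj_eq (@expR_inj R)) oppr_eq0. Qed.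

Let fixed_eq0 (r a : R) : r != 0 -> expR (- r) * a = a -> a = 0.
Proof.
move=> /exp_neq1 r1 /eqP; rewrite -subr_eq0 -{2}[a]mul1r -mulrBl mulf_eq0.
by rewrite subr_eq0 (negbTE r1) => /eqP.
Qed.

Lemma eigenfunction_mean0 r f : eig r f -> f \in L2 -> r != 0 ->
  \int[nu]_x f x = 0.
Proof.
move=> ef Lf r0; apply: (fixed_eq0 r0).
rewrite -inner_cst1; apply: EFin_inj.
have := integral_eigenfunction hX hinv ef (lexx 0) ler01 Lf cst1_L2.
rewrite subr0 mulr1 => <-.
under eq_integral do rewrite mulr1.
rewrite (integral_markov hX hinv (F := EFin \o f) ler01); last first.
  by apply/measurable_EFinP; exact: Lfun_measurable Lf.
by rewrite -innerE//; apply: eq_integral => x _; rewrite mulr1.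
Qed.

(** The increment between times [0] and [1] has second moment twice
    [inner nu f f] minus twice the inner product of the transition of [f] with
    [f], which is zero. *)
Lemma fixed_function_path f : eig 0 f -> f \in L2 ->
  {ae Q, forall w, f (X 1 w) = f (X 0 w)}.
Proof.
move=> ef Lf; have mf := Lfun_measurable Lf.
have mfX t : 0 <= t -> measurable_fun setT (f \o X t).
  by move=> t0; apply: measurableT_comp => //; exact: (measurable_markov hX).
have int2 u v : 0 <= v -> v <= u ->
    (\int[Q]_w (f (X u w) * f (X v w))%:E = (inner nu f f)%:E)%E.
  move=> v0 vu; rewrite (integral_eigenfunction hX hinv ef)//.
  by rewrite oppr0 mul0r expR0 mul1r.
have iq u v : 0 <= u -> 0 <= v ->
    Q.-integrable setT (fun w => (f (X u w) * f (X v w))%:E).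
  by move=> u0 v0; exact: (integrable_markov_mul hX hinv).
have sq0 : (\int[Q]_w ((f (X 1 w) - f (X 0 w)) ^+ 2)%:E = 0)%E.
  transitivity (\int[Q]_w ((f (X 1 w) * f (X 1 w))%:E +
     (f (X 0 w) * f (X 0 w))%:E - (f (X 1 w) * f (X 0 w))%:E
     - (f (X 1 w) * f (X 0 w))%:E))%E.
    apply: eq_integral => w _; pose a := f (X 1 w); pose b := f (X 0 w).
    transitivity (a * a + b * b - a * b - a * b)%:E => //.
    by congr EFin; rewrite /a /b; ring.
  have i11 := iq 1 1 ler01 ler01; have i00 := iq 0 0 (lexx _) (lexx _).
  have i10 := iq 1 0 ler01 (lexx _).
  rewrite integralB//; last by apply: integrableB => //; exact: integrableD.
  rewrite integralB//; last exact: integrableD.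
  rewrite integralD// !int2//.
  pose i := inner nu f f; transitivity (i + i - i - i)%:E => //.
  by congr EFin; ring.
have : ae_eq Q setT (fun w => ((f (X 1 w) - f (X 0 w)) ^+ 2)%:E) (cst 0%E).
  apply/(ae_eq_integral_abs Q measurableT _).1.
    apply/measurable_EFinP; apply: measurable_funX; apply: measurable_funB.
      exact: (mfX 1 ler01).
    exact: (mfX 0 (lexx _)).
  by rewrite -[RHS]sq0; apply: eq_integral => w _; rewrite gee0_abs// lee_fin sqr_ge0.
apply: filterS => w /(_ I) []/eqP; rewrite sqrf_eq0 subr_eq0 => /eqP.
by [].
Qed.

Lemma fixed_function_orthogonal r f g : eig 0 f -> eig r g ->
  f \in L2 -> g \in L2 -> r != 0 -> inner nu g f = 0.
Proof.
move=> ef eg Lf Lg r0; apply: (fixed_eq0 r0); apply: EFin_inj.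
have mf := Lfun_measurable Lf; have mg := Lfun_measurable Lg.
have := integral_eigenfunction hX hinv eg (lexx 0) ler01 Lg Lf.
rewrite subr0 mulr1 => <-.
rewrite -innerE// -(integral_markov hX hinv (F := fun x => (g x * f x)%:E) ler01).
  apply: ae_eq_integral => //.
  - apply/measurable_EFinP; apply: measurable_funM; apply: measurableT_comp => //;
      exact: (measurable_markov hX).
  - apply/measurable_EFinP; apply: measurable_funM; apply: measurableT_comp => //;
      exact: (measurable_markov hX).
  - by apply: filterS (fixed_function_path ef Lf) => w -> _.
by apply/measurable_EFinP; exact: measurable_funM.
Qed.

Variable Pstar : R -> (E -> R) -> (E -> R).
Hypothesis hPstar : forall t : R, 0 <= t ->
  is_adjoint nu (semigroup Px X t) (Pstar t).

Let adjoint_pairing r h f V : 0 <= h -> f \in L2 -> V \in L2 ->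
  ae_eq nu setT (Pstar h V) (fun x => expR (- r * h) * V x) ->
  inner nu (semigroup Px X h f) V = expR (- r * h) * inner nu f V.
Proof.
move=> h0 Lf LV eV; have [PL adj] := hPstar h0.
have mf := Lfun_measurable Lf; have mV := Lfun_measurable LV.
rewrite adj// innerC (inner_ae_eq _ _ mf eV).
- by rewrite innerZl// innerC.
- exact: Lfun_measurable (PL _ LV).
- exact: measurable_funM.
Qed.

Lemma coeigenfunction_biorthogonal r r' f V : eig r f -> f \in L2 -> V \in L2 ->
  ae_eq nu setT (Pstar 1 V) (fun x => expR (- r' * 1) * V x) ->
  r != r' -> inner nu f V = 0.
Proof.
move=> ef Lf LV eV rr'; have mf := Lfun_measurable Lf.
have := adjoint_pairing ler01 Lf LV eV.
rewrite (inner_ae_eq _ _ (Lfun_measurable LV) (ef 1 ler01)); last 2 first.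
- exact: (measurable_semigroup hX).
- exact: measurable_funM.
rewrite innerZl// => /eqP; rewrite -subr_eq0 -mulrBl mulf_eq0 subr_eq0.
rewrite (inj_eq (@expR_inj R)) !mulr1 eqr_opp (negbTE rr') => /eqP //.
Qed.

Lemma coeigenfunction_mean0 r V : V \in L2 ->
  ae_eq nu setT (Pstar 1 V) (fun x => expR (- r * 1) * V x) ->
  r != 0 -> \int[nu]_x V x = 0.
Proof.
move=> LV eV r0; rewrite -inner_cst1 innerC.
apply: (@coeigenfunction_biorthogonal 0 r) => //; last by rewrite eq_sym.
move=> h h0; apply: aeW => x _; rewrite oppr0 mul0r expR0 mul1r.
rewrite /semigroup /Rintegral (eq_integral (cst 1%E))// integral_cst// mul1e.
by transitivity (fine (1%E : \bar R)) => //; congr fine; exact: prob_kernel.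
Qed.

End eigenfunction_theory.

(** * The process at independent random times *)

Section history_spaces.
Context {R : realType} {dO dS : measure_display}.
Context {Omega : measurableType dO} {S : measurableType dS}.
Variable Y : R -> Omega -> S.

(** A measurable space of its own, so that the law of the identity map into it is
    the restriction of the probability to the history: independent processes
    become independent random elements. *)
Definition history_space := g_sigma_algebraType
  [set A | exists u B, [/\ (`[0, +oo[%classic : set R) u, measurable B & A = Y u @^-1` B]].

Lemma measurable_to_history :
  (forall u : R, 0 <= u -> measurable_fun setT (Y u)) ->
  measurable_fun setT (id : Omega -> history_space).
Proof.
move=> mY _ A mA; rewrite setTI preimage_id.
apply: (@smallest_sub _ _ _ _ _ _ A mA); first exact: sigma_algebra_measurable.
move=> _ [u [B [u0 mB ->]]]; rewrite -[X in measurable X]setTI.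
by apply: mY => //; move: u0; rewrite /= in_itv/= andbT.
Qed.

Lemma measurable_from_history u : 0 <= u ->
  measurable_fun setT (Y u : history_space -> S).
Proof.
move=> u0 _ B mB; rewrite setTI; apply: sub_gen_smallest.
by exists u, B; split => //=; rewrite in_itv/= u0.
Qed.

End history_spaces.

Section random_times.
Context {R : realType} {dE dO : measure_display}.
Context {E : measurableType dE} {Omega : measurableType dO}.
Variables (Px : R.-pker E ~> Omega) (X : R -> Omega -> E).
Hypothesis hX : markov_process Px X.
Variable nu : probability E R.
Hypothesis hinv : invariant_measure Px X nu.
Variable T : R -> Omega -> R.
Hypothesis mT : forall t : R, 0 <= t -> measurable_fun setT (T t).
Hypothesis hindep : independent_processes (Pinit Px nu) X T.

Local Notation Q := (Pinit Px nu).
Local Notation L2 := (Lfun nu 2%:E).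
Local Notation OX := (history_space X).
Local Notation OT := (history_space T).

Let idX : measurable_fun setT (id : Omega -> OX).
Proof. by apply: measurable_to_history => u u0; exact: (measurable_markov hX). Qed.

Let idT : measurable_fun setT (id : Omega -> OT).
Proof. exact: measurable_to_history. Qed.

Let indep A B : measurable A -> measurable B ->
  Q ((id : Omega -> OX) @^-1` A `&` (id : Omega -> OT) @^-1` B) =
  (Q ((id : Omega -> OX) @^-1` A) * Q ((id : Omega -> OT) @^-1` B))%E.
Proof. by move=> mA mB; rewrite !preimage_id; exact: hindep. Qed.

(** The process at a time read on the second coordinate: joint measurability
    with respect to the history of [X] is what allows Fubini below. *)
Let measurable_at_time (S : OT -> R) : measurable_fun setT S ->
  (forall w, 0 <= S w) ->
  measurable_fun setT (fun p : OX * OT => X (S p.2) p.1).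
Proof.
move=> mS S0 _ A mA; rewrite setTI.
have [_ /(_ A mA) mXA] := markov_measurable hX.
have mXA' : measurable ((`[0, +oo[ `*` [set: Omega]) `&`
    [set p : R * Omega | A (X p.1 p.2)] : set (R * OX)).
  by rewrite measurable_prod_measurableType.
have mSp : measurable_fun setT (fun p : OX * OT => (S p.2, p.1) : R * OX).
  by apply: measurable_fun_pair => //; exact: measurableT_comp.
have := mSp measurableT _ mXA'; rewrite setTI.
congr (measurable _); apply/seteqP; split => -[w1 w2] /=.
  by case.
by move=> Aw; split => //; split => //=; rewrite in_itv/= S0.
Qed.

Lemma measurable_stopped (S : OT -> R) : measurable_fun setT S ->
  (forall w, 0 <= S w) -> measurable_fun setT (fun w : Omega => X (S w) w).
Proof.
move=> mS S0.
have mdiag : measurable_fun setT (fun w : Omega => (w, w) : OX * OT).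
  exact: measurable_fun_pair.
exact: (measurableT_comp (measurable_at_time mS S0) mdiag).
Qed.

Let ge0_integral_stopped (S : OT -> R) (F : E -> \bar R) :
  measurable_fun setT S -> (forall w, 0 <= S w) ->
  measurable_fun setT F -> (forall x, 0 <= F x)%E ->
  (\int[Q]_w F (X (S w) w) = \int[nu]_x F x)%E.
Proof.
move=> mS S0 mF F0.
have mFX := measurableT_comp mF (measurable_at_time mS S0).
have := ge0_integral_indep idX idT indep mFX (fun p => F0 _).
rewrite /= => ->.
under eq_integral do rewrite (integral_markov hX hinv (S0 _) mF).
rewrite integral_cst// -[RHS]mule1; congr (_ * _)%E.
exact: probability_setT.
Qed.

Lemma integrable_stopped (S : OT -> R) (F : E -> \bar R) :
  measurable_fun setT S -> (forall w, 0 <= S w) ->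
  nu.-integrable setT F -> Q.-integrable setT (fun w => F (X (S w) w)).
Proof.
move=> mS S0 /integrableP[mF iF]; apply/integrableP; split.
  by apply: (measurableT_comp mF); exact: measurable_stopped.
have mA : measurable_fun setT (abse \o F) by exact: measurableT_comp.
by rewrite (ge0_integral_stopped mS S0 mA)// => x /=; exact: abse_ge0.
Qed.

Lemma integral_stopped (S : OT -> R) (F : E -> \bar R) :
  measurable_fun setT S -> (forall w, 0 <= S w) ->
  nu.-integrable setT F -> (\int[Q]_w F (X (S w) w) = \int[nu]_x F x)%E.
Proof.
move=> mS S0 iF; have mF := measurable_int _ iF.
have mFX := measurableT_comp mF (measurable_at_time mS S0).
have := integral_indep idX idT indep mFX (integrable_stopped mS S0 iF).
rewrite /= => ->.
under eq_integral do rewrite (integral_markov hX hinv (S0 _) mF).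
have Ifin : (\int[nu]_x F x)%E \is a fin_num by exact: integrable_fin_num.
rewrite integral_cst// -[RHS]mule1; congr (_ * _)%E.
exact: probability_setT.
Qed.

Lemma integrable_stopped_mul (S1 S2 : OT -> R) f g :
  measurable_fun setT S1 -> (forall w, 0 <= S1 w) ->
  measurable_fun setT S2 -> (forall w, 0 <= S2 w) ->
  f \in L2 -> g \in L2 ->
  Q.-integrable setT (fun w => (f (X (S1 w) w) * g (X (S2 w) w))%:E).
Proof.
move=> mS1 S10 mS2 S20 Lf Lg.
apply: (@integrable_mul _ _ _ Q (fun w => f (X (S1 w) w)) (fun w => g (X (S2 w) w))).
- apply: measurableT_comp; first exact: Lfun_measurable Lf.
  exact: measurable_stopped.
- apply: measurableT_comp; first exact: Lfun_measurable Lg.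
  exact: measurable_stopped.
- exact: (integrable_stopped mS1 S10 (Lfun2_integrable_sqr Lf)).
- exact: (integrable_stopped mS2 S20 (Lfun2_integrable_sqr Lg)).
Qed.

(** Independence freezes the times at [S1 w'] and [S2 w'], where the formula for
    deterministic times applies; hence the order is required at every [w']. *)
Lemma integral_eigenfunction_stopped r f g (S1 S2 : OT -> R) :
  measurable_fun setT S1 -> measurable_fun setT S2 ->
  (forall w, 0 <= S2 w) -> (forall w, S2 w <= S1 w) ->
  eigenfunction Px X nu r f -> f \in L2 -> g \in L2 ->
  (\int[Q]_w (f (X (S1 w) w) * g (X (S2 w) w))%:E =
   \int[Q]_w (expR (- r * (S1 w - S2 w)) * inner nu f g)%:E)%E.
Proof.
move=> mS1 mS2 S20 S21 ef Lf Lg.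
have S10 w : 0 <= S1 w by exact: le_trans (S21 w).
pose F (p : OX * OT) := (f (X (S1 p.2) p.1) * g (X (S2 p.2) p.1))%:E.
have mF : measurable_fun setT F.
  apply/measurable_EFinP; apply: measurable_funM.
  - apply: (measurableT_comp (Lfun_measurable Lf)).
    exact: measurable_at_time.
  - apply: (measurableT_comp (Lfun_measurable Lg)).
    exact: measurable_at_time.
have iF := integrable_stopped_mul mS1 S10 mS2 S20 Lf Lg.
have := integral_indep idX idT indep mF iF.
rewrite /F/= => ->; apply: eq_integral => w _.
exact: (integral_eigenfunction hX hinv ef).
Qed.

End random_times.

(** * Correlations of the time-changed process *)

Section time_changed_correlation.
Context {R : realType} {dE dO : measure_display}.
Context {E : measurableType dE} {Omega : measurableType dO}.
Variables (Px : R.-pker E ~> Omega) (X : R -> Omega -> E).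
Hypothesis hX : markov_process Px X.
Variable nu : probability E R.
Hypothesis hinv : invariant_measure Px X nu.
Variable T : R -> Omega -> R.

Local Notation Q := (Pinit Px nu).
Local Notation L2 := (Lfun nu 2%:E).
Local Notation inv := (inverse_subordinator T).
Local Notation L t := (fun w => fine (inv t w)).
Local Notation Y := (time_changed X T).

Hypothesis hT : subordinator Q T.
Hypothesis hindep : independent_processes Q X T.
Hypothesis hfin : forall t : R, 0 <= t -> Q [set w | (inv t w < +oo)%E] = 1%E.

Let mT := @sub_measurable _ _ _ _ _ hT.

Let mL t : measurable_fun setT (L t : history_space T -> R).
Proof.
apply: measurableT_comp => //; apply: measurable_inverse_subordinator.
  exact: (sub_nondecreasing hT).
by move=> u u0; exact: measurable_from_history.
Qed.

Let L0 t w : 0 <= fine (inv t w).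
Proof. exact: fine_inverse_ge0. Qed.

Lemma integral_time_changed (F : E -> R) t :
  nu.-integrable setT (EFin \o F) -> \int[Q]_w F (Y t w) = \int[nu]_x F x.
Proof.
move=> iF; rewrite /Rintegral.
by rewrite -(integral_stopped hX hinv mT hindep (mL t) (@L0 t) iF).
Qed.

(** Common to all the correlations: the mean of [expR (- r * (L t - L s))]. *)
Definition correlation_factor (r t s : R) : R :=
  r * renewal_integral Q T s (fun u => inverse_laplace Q T (t - u) r) +
  inverse_laplace Q T t r.

Lemma integral_time_changed_mul r f g s t : 0 <= r -> 0 <= s -> s <= t ->
  eigenfunction Px X nu r f -> f \in L2 -> g \in L2 ->
  \int[Q]_w (f (Y t w) * g (Y s w)) = inner nu f g * correlation_factor r t s.
Proof.
move=> r0 s0 st ef Lf Lg.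
(* [L s] exceeds [L t] only when [L t] is infinite and read as [0]; the minimum
   restores the order everywhere *)
pose S := (fun w => Num.min (fine (inv s w)) (fine (inv t w))) : history_space T -> R.
have mS : measurable_fun setT S by exact: measurable_minr.
have S0 w : 0 <= S w by rewrite /S le_min !L0.
have SL w : S w <= fine (inv t w) by rewrite /S ge_min lexx orbT.
have SE : {ae Q, forall w : Omega, S w = fine (inv s w)}.
  apply: filterS (inverse_ae_finiteT hT hfin t) => w ity.
  by rewrite /S min_l// le_fine_inverse.
have mfun (S1 S2 : history_space T -> R) : measurable_fun setT S1 ->
    (forall w, 0 <= S1 w) -> measurable_fun setT S2 -> (forall w, 0 <= S2 w) ->
    measurable_fun setT (fun w : Omega => (f (X (S1 w) w) * g (X (S2 w) w))%:E).
  move=> mS1 S10 mS2 S20.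
  exact: (measurable_int _ (integrable_stopped_mul hX hinv mT hindep mS1 S10 mS2 S20 Lf Lg)).
have mfromT (H : history_space T -> R) :
    measurable_fun setT H -> measurable_fun setT (H : Omega -> R).
  by move=> mH; apply: (measurableT_comp mH); exact: measurable_to_history.
pose D w := expR (- r * (fine (inv t w) - S w)).
have mD : measurable_fun setT D.
  apply: measurableT_comp => //; apply: measurable_funM => //.
  by apply: measurable_funB; exact: mfromT.
have iD : Q.-integrable setT (EFin \o D).
  apply: (@le_integrable _ _ _ _ _ measurableT _ (cst 1%E)).
  - exact/measurable_EFinP.
  - move=> w _ /=; rewrite lee_fin normr1 ger0_norm ?expR_ge0//.
    by rewrite -expR0 ler_expR mulNr oppr_le0 mulr_ge0// subr_ge0.
  - exact: finite_measure_integrable_cst.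
rewrite /correlation_factor -(renewal_identity hT hfin r0 s0 st).
transitivity (\int[Q]_w (D w * inner nu f g)).
  rewrite /Rintegral; congr fine.
  rewrite -(integral_eigenfunction_stopped hX hinv mT hindep (mL t) mS S0 SL ef Lf Lg).
  apply: ae_eq_integral => //.
  - by apply: (mfun (L t) (L s)) => //; exact: L0.
  - by apply: (mfun (L t) S) => //; exact: L0.
  - by apply: filterS SE => w SEw _; rewrite SEw.
rewrite RintegralZr// mulrC; congr (_ * _); congr fine.
apply: ae_eq_integral => //.
- exact/measurable_EFinP.
- apply/measurable_EFinP; apply: measurableT_comp => //.
  by apply: measurable_funM => //; apply: measurable_funB; exact: mfromT.
- by apply: filterS SE => w SEw _; rewrite /D SEw.
Qed.

Let L2_integrable f : f \in L2 -> nu.-integrable setT (EFin \o f).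
Proof.
move=> Lf; apply/Lfun1_integrable; apply: Lfun_subset12 Lf.
by rewrite fin_num_measure.
Qed.

Lemma cov_time_changed r f g s t : 0 <= r -> 0 <= s -> s <= t ->
  eigenfunction Px X nu r f -> f \in L2 -> g \in L2 ->
  cov Q (f \o Y t) (g \o Y s) =
  inner nu f g * correlation_factor r t s - \int[nu]_x f x * \int[nu]_x g x.
Proof.
move=> r0 s0 st ef Lf Lg; rewrite /cov/= (integral_time_changed_mul r0)//.
by rewrite !integral_time_changed//; exact: L2_integrable.
Qed.

Lemma std_time_changed f t : f \in L2 -> \int[nu]_x f x = 0 ->
  std Q (f \o Y t) = normL2 nu f.
Proof.
move=> Lf f0; rewrite /std /normL2 /cov/=.
rewrite (integral_time_changed t (L2_integrable Lf)) f0 mulr0 subr0.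
rewrite (@integral_time_changed (fun x => f x * f x) t)//.
exact: Lfun2_integrable.
Qed.

(** In the second alternative the standard deviations may differ from the norms,
    but both sides vanish. *)
Lemma corr_time_changed r f g s t : 0 <= r -> 0 <= s -> s <= t ->
  eigenfunction Px X nu r f -> f \in L2 -> g \in L2 ->
  (\int[nu]_x f x = 0 /\ \int[nu]_x g x = 0) \/
  (inner nu f g = 0 /\ \int[nu]_x f x * \int[nu]_x g x = 0) ->
  corr Q (f \o Y t) (g \o Y s) =
  inner nu f g / (normL2 nu f * normL2 nu g) * correlation_factor r t s.
Proof.
move=> r0 s0 st ef Lf Lg; rewrite /corr (cov_time_changed r0 s0 st ef Lf Lg).
move=> [[f0 g0]|[fg0 ->]].
  rewrite !std_time_changed// f0 mul0r subr0; case: ifPn => [_|].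
    by rewrite mulrAC.
  rewrite -leNgt => n0; have -> : normL2 nu f * normL2 nu g = 0.
    by apply/eqP; rewrite eq_le n0 mulr_ge0// sqrtr_ge0.
  by rewrite invr0 mulr0 mul0r.
by rewrite fg0 !mul0r subr0 mul0r; case: ifP.
Qed.

Lemma correlation_factor_bounds r s t : 0 <= r -> 0 <= s -> s <= t ->
  inverse_laplace Q T t r * (r * mean_inverse Q T s + 1) <= correlation_factor r t s /\
  correlation_factor r t s <=
    inverse_laplace Q T (t - s) r * (r * mean_inverse Q T s + 1).
Proof.
move=> r0 s0 st; rewrite /correlation_factor.
have := r0; rewrite le_eqVlt => /predU1P[<-|r1].
  by rewrite !mul0r !add0r !(inverse_laplace0 hT) mulr1.
have [lb ub] := renewal_integral_bounds hT hfin r1 s0 st.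
have mono : inverse_laplace Q T t r <= inverse_laplace Q T (t - s) r.
  by apply: (inverse_laplace_nonincreasing hT hfin) => //; rewrite gerBl.
move: lb ub mono; move: (inverse_laplace _ _ _ _) (inverse_laplace _ _ _ _)
  (mean_inverse _ _ _) (renewal_integral _ _ _ _) => eta_t eta_ts M W lb ub mono.
have distr x : x * (r * M + 1) = r * (x * M) + x by ring.
rewrite !distr; split; first by rewrite lerD2r; exact: ler_wpM2l.
by apply: lerD => //; exact: ler_wpM2l.
Qed.

Lemma mean_inverse_ge0 s : 0 <= mean_inverse Q T s.
Proof. by apply: Rintegral_ge0 => w _; exact: L0. Qed.

End time_changed_correlation.

(** * Asymptotic comparison *)

Section asymptotics.
Context {R : realType}.
Implicit Types (eta g rho : R -> R) (A C s c : R).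

Lemma ratio_eventually_bounded eta s C : (forall t, 0 < eta t) ->
  limf_esup (fun t => (eta (t - s) / eta t)%:E) (pinfty_nbhs R) = C%:E ->
  exists t0 M : R, [/\ 0 < t0, s <= t0, 1 <= M &
    forall t, t0 <= t -> eta (t - s) <= M * eta t].
Proof.
move=> eta0 supE.
have : (limf_esup (fun t => (eta (t - s) / eta t)%:E) (pinfty_nbhs R) <
        (C + 1)%:E)%E by rewrite supE lte_fin ltrDl.
rewrite limf_esupE => /ereal_inf_lt[_ [V [a [_ aV]] <-]] supV.
exists (Num.max 1 (Num.max s (a + 1))), (Num.max 1 (C + 1)); split.
- by rewrite lt_max ltr01.
- by rewrite !le_max lexx orbT.
- by rewrite le_max lexx.
move=> t; rewrite !ge_max => /and3P[_ _ at1].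
have Vt : V t by apply: aV; rewrite (lt_le_trans _ at1)// ltrDl.
have : ((eta (t - s) / eta t)%:E < (C + 1)%:E)%E.
  by apply: le_lt_trans supV; apply: ereal_sup_ubound; exists t.
rewrite lte_fin ltr_pdivrMr// => /ltW /le_trans; apply.
by apply: ler_wpM2r; [exact: ltW|rewrite le_max lexx orbT].
Qed.

(** A negative factor [c] reverses the inequalities, and then the constant is
    [M^-1] instead of [M]. *)
Lemma asymp_bounded_sandwich eta g rho c A s t0 M : 0 < A -> 1 <= M ->
  (forall t, 0 < eta t) ->
  (forall t, t0 <= t -> [/\ rho t = c * g t, eta t * A <= g t,
     g t <= eta (t - s) * A & eta (t - s) <= M * eta t]) ->
  asymp_bounded t0 rho (fun t => c * (eta t * A)).
Proof.
move=> A0 M1 eta0 H.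
have M0 : 0 < M by exact: lt_le_trans M1.
have hg t : t0 <= t -> eta t * A <= g t <= M * (eta t * A).
  move=> /H[_ -> /le_trans gle etaM]; apply: gle.
  by rewrite mulrA ler_wpM2r// ltW.
have hM t : t0 <= t -> M^-1 * (eta t * A) <= g t.
  move=> /hg/andP[+ _]; apply: le_trans; rewrite ler_piMl ?invf_le1//.
  by rewrite mulr_ge0// ltW.
have hM' t : t0 <= t -> M^-1 * g t <= eta t * A.
  by move=> /hg/andP[_]; rewrite ler_pdivrMl.
have [c0|/ltW c0] := leP 0 c.
  exists M; split => // t tt; have [-> _ _ _] := H t tt.
  have /andP[_ g2] := hg t tt.
  by split; rewrite mulrCA; apply: ler_wpM2l => //; exact: hM.
exists M^-1; split; first by rewrite invr_gt0.
move=> t tt; have [-> _ _ _] := H t tt; have /andP[g1 g2] := hg t tt.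
by split; rewrite ?invrK mulrCA; apply: ler_wnM2l => //; exact: hM.
Qed.

Lemma long_tailed_shift eta s : (forall t, 0 < eta t) -> long_tailed eta -> 0 < s ->
  eta (t - s) / eta t @[t --> +oo] --> (1 : R).
Proof.
move=> eta0 lt s0.
have H : eta (x + s) / eta x @[x --> +oo] --> (1 : R).
  have := lt s s0; rewrite /asymp_equiv; apply: cvg_trans; apply: near_eq_cvg.
  by near=> x; rewrite gt_eqF.
have H1 : (eta (x + s) / eta x)^-1 @[x --> +oo] --> (1 : R).
  by rewrite -[X in _ --> X]invr1; apply: cvgV => //; exact: oner_neq0.
have sh : (t - s) @[t --> +oo] --> +oo.
  move=> V [a [_ aV]]; exists (a + s); split; first exact: num_real.
  by move=> t ast; apply: aV; rewrite ltrBrDr.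
have := cvg_comp _ _ sh H1.
apply: cvg_trans; apply: near_eq_cvg; near=> t => /=.
by rewrite subrK invf_div.
Unshelve. all: by end_near. Qed.

Lemma asymp_equiv_sandwich eta g rho c A s : 0 < A -> (forall t, 0 < eta t) ->
  long_tailed eta -> 0 < s ->
  (forall t, s <= t -> [/\ rho t = c * g t, eta t * A <= g t &
     g t <= eta (t - s) * A]) ->
  asymp_equiv rho (fun t => c * (eta t * A)).
Proof.
move=> A0 eta0 lt s0 H; rewrite /asymp_equiv.
apply: (@squeeze_cvgr _ _ _ _ (cst 1) (fun t => eta (t - s) / eta t)).
- near=> t; have st : s <= t by near: t; apply: nbhs_pinfty_ge; exact: num_real.
  have [-> g1 g2] := H t st.
  have eA : 0 < eta t * A by rewrite mulr_gt0.
  have [->|c0] := eqVneq c 0.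
    (* [0 / 0] is read as [1], and [eta (t - s) / eta t] is at least [1] *)
    rewrite !mul0r eqxx /= lexx /= ler_pdivlMr// mul1r.
    by rewrite -(ler_pM2r A0); exact: le_trans g2.
  rewrite !mulf_eq0 (negbTE c0)/= (gt_eqF A0) (gt_eqF (eta0 t))/= andbF.
  rewrite -mulf_div divff// mul1r ler_pdivlMr// mul1r g1/=.
  by rewrite ler_pdivrMr// mulrA divfK// gt_eqF.
- exact: cvg_cst.
- exact: long_tailed_shift.
Unshelve. all: by end_near. Qed.

End asymptotics.

(** * The correlation structure *)

Theorem theorem2p2 (R : realType)
  (* the state space, a subset of R with some sigma-algebra *)
  (dE : measure_display) (E : measurableType dE)
  (iota : E -> R) (iota_inj : injective iota)
  (* the Markov process and its invariant probability measure *)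
  (dO : measure_display) (Omega : measurableType dO)
  (Px : R.-pker E ~> Omega) (X : R -> Omega -> E)
  (hX : markov_process Px X)
  (nu : probability E R)
  (hcont : continuous_semigroup Px X nu)
  (hinv : invariant_measure Px X nu)
  (Pstar : R -> (E -> R) -> (E -> R))
  (hPstar : forall t : R, 0 <= t -> is_adjoint nu (semigroup Px X t) (Pstar t))
  (* eigenvalues, eigenfunctions and co-eigenfunctions *)
  (N : set nat) (lambda : nat -> R) (eigP eigV : nat -> E -> R)
  (hlambda_ge0 : forall k, N k -> 0 <= lambda k)
  (hlambda_inj : forall k l, N k -> N l -> lambda k = lambda l -> k = l)
  (heigP_L2 : forall k, N k -> eigP k \in Lfun nu 2%:E)
  (heigV_L2 : forall k, N k -> eigV k \in Lfun nu 2%:E)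
  (heigP : forall k (t : R), N k -> 0 <= t ->
     ae_eq nu setT (semigroup Px X t (eigP k))
       (fun x => expR (- lambda k * t) * eigP k x))
  (heigV : forall k (t : R), N k -> 0 <= t ->
     ae_eq nu setT (Pstar t (eigV k))
       (fun x => expR (- lambda k * t) * eigV k x))
  (hnormalized : forall k, N k -> inner nu (eigP k) (eigV k) = 1)
  (* the subordinator, independent of X *)
  (T : R -> Omega -> R) (drift : R) (theta : {measure set R -> \bar R})
  (hdrift : 0 <= drift) (htheta : levy_measure theta)
  (hT : subordinator (Pinit Px nu) T)
  (hphi : has_laplace_exponent (Pinit Px nu) T (levy_khintchine drift theta))
  (hindep : independent_processes (Pinit Px nu) X T)
  (hfinite : forall t : R, 0 <= t ->
     Pinit Px nu [set w | (inverse_subordinator T t w < +oo)%E] = 1%E)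
  (m n : nat) (hm : N m) (hn : N n)
  (* the degenerate case of a non-centred eigenfunction of eigenvalue 0 *)
  (hcentred : m = n -> lambda m = 0 ->
     \int[nu]_x eigP m x = 0 /\ \int[nu]_x eigV m x = 0) :
  let c := inner nu (eigP n) (eigP m) /
             (normL2 nu (eigP n) * normL2 nu (eigP m)) in
  let kappa := normL2 nu (eigP m) * normL2 nu (eigV m) in
  let kd := kappa^-1 * (m == n)%:R in
  let eta_ (t : R) := inverse_laplace (Pinit Px nu) T t (lambda m) in
  let EL (s : R) := mean_inverse (Pinit Px nu) T s in
  let Y (t : R) := time_changed X T t in
  let rhoP (t s : R) := corr (Pinit Px nu) (eigP m \o Y t) (eigP n \o Y s) in
  let rhoV (t s : R) := corr (Pinit Px nu) (eigP m \o Y t) (eigV n \o Y s) in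
  let G (t s : R) :=
    lambda m * renewal_integral (Pinit Px nu) T s (fun r => eta_ (t - r))
      + eta_ t in
  (forall t s : R, 0 < s -> s <= t ->
     rhoP t s = c * G t s /\ rhoV t s = kd * G t s) /\
  (forall t s : R, 0 < s -> s <= t ->
     [/\ 0 <= c ->
           c * (eta_ t * (lambda m * EL s + 1)) <= rhoP t s /\
           rhoP t s <= c * (eta_ (t - s) * (lambda m * EL s + 1)),
         c <= 0 ->
           c * (eta_ (t - s) * (lambda m * EL s + 1)) <= rhoP t s /\
           rhoP t s <= c * (eta_ t * (lambda m * EL s + 1)) &
         kd * (eta_ t * (lambda m * EL s + 1)) <= rhoV t s /\
         rhoV t s <= kd * (eta_ (t - s) * (lambda m * EL s + 1))]) /\
  (forall s C : R, 0 < s -> 0 < C ->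
     limf_esup (fun t => (eta_ (t - s) / eta_ t)%:E) (pinfty_nbhs R) = C%:E ->
     exists t0 : R, [/\ 0 < t0,
       asymp_bounded t0 (fun t => rhoP t s)
         (fun t => c * (eta_ t * (lambda m * EL s + 1))) &
       asymp_bounded t0 (fun t => rhoV t s)
         (fun t => kd * (eta_ t * (lambda m * EL s + 1)))]) /\
  (long_tailed eta_ -> forall s : R, 0 < s ->
     asymp_equiv (fun t => rhoP t s)
       (fun t => c * (eta_ t * (lambda m * EL s + 1))) /\
     asymp_equiv (fun t => rhoV t s)
       (fun t => kd * (eta_ t * (lambda m * EL s + 1)))).
Proof.
pose Q := Pinit Px nu.
have eP k : N k -> eigenfunction Px X nu (lambda k) (eigP k).
  by move=> Nk h h0; exact: heigP.
have l0 := hlambda_ge0 m hm.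
have meanP k : N k -> lambda k != 0 -> \int[nu]_x eigP k x = 0.
  by move=> Nk; exact: (eigenfunction_mean0 hX hinv (eP k Nk) (heigP_L2 k Nk)).
have meanV k : N k -> lambda k != 0 -> \int[nu]_x eigV k x = 0.
  by move=> Nk; exact: (coeigenfunction_mean0 hX hPstar (heigV_L2 k Nk)
    (heigV k 1 Nk ler01)).
have lambda_neq : m != n -> lambda m != lambda n.
  by apply: contra_neq; exact: hlambda_inj.
have centredP : (\int[nu]_x eigP m x = 0 /\ \int[nu]_x eigP n x = 0) \/
    (inner nu (eigP m) (eigP n) = 0 /\
     \int[nu]_x eigP m x * \int[nu]_x eigP n x = 0).
  have [mn|mn] := eqVneq m n.
    rewrite -mn; have [lm0|lm0] := eqVneq (lambda m) 0.
      by left; have [-> _] := hcentred mn lm0.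
    by left; rewrite meanP.
  have := lambda_neq mn; have [lm0|lm0] := eqVneq (lambda m) 0 => lmn.
    have ln0 : lambda n != 0 by rewrite -lm0 eq_sym.
    right; rewrite (meanP n)// mulr0 innerC; split => //.
    apply: (fixed_function_orthogonal hX hinv _ (eP n hn)) => //;
      [by rewrite -lm0; exact: eP|exact: heigP_L2|exact: heigP_L2].
  have [ln0|ln0] := eqVneq (lambda n) 0; last by left; rewrite !meanP.
  right; rewrite (meanP m)// mul0r; split => //.
  apply: (fixed_function_orthogonal hX hinv _ (eP m hm)) => //;
    [by rewrite -ln0; exact: eP|exact: heigP_L2|exact: heigP_L2].
have biorth : m != n -> inner nu (eigP m) (eigV n) = 0.
  move=> mn; apply: (coeigenfunction_biorthogonal hX hPstar (eP m hm)
    (heigP_L2 m hm) (heigV_L2 n hn) (heigV n 1 hn ler01)).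
  exact: lambda_neq.
have centredV : (\int[nu]_x eigP m x = 0 /\ \int[nu]_x eigV n x = 0) \/
    (inner nu (eigP m) (eigV n) = 0 /\
     \int[nu]_x eigP m x * \int[nu]_x eigV n x = 0).
  have [mn|mn] := eqVneq m n.
    rewrite -mn; left; have [lm0|lm0] := eqVneq (lambda m) 0.
      exact: hcentred.
    by rewrite meanP// meanV.
  right; split; first exact: biorth.
  have [lm0|lm0] := eqVneq (lambda m) 0; last by rewrite meanP ?mul0r.
  by rewrite meanV ?mulr0// -lm0 eq_sym; exact: lambda_neq.
move=> c kappa kd eta_ EL Y rhoP rhoV G.
have rhoPE t s : 0 < s -> s <= t -> rhoP t s = c * G t s.
  move=> s0 st; rewrite /rhoP /c innerC [normL2 nu (eigP n) * _]mulrC.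
  exact: (corr_time_changed hX hinv hT hindep hfinite l0 (ltW s0) st (eP m hm)
    (heigP_L2 m hm) (heigP_L2 n hn) centredP).
have rhoVE t s : 0 < s -> s <= t -> rhoV t s = kd * G t s.
  move=> s0 st; transitivity (inner nu (eigP m) (eigV n) /
    (normL2 nu (eigP m) * normL2 nu (eigV n)) * G t s).
    exact: (corr_time_changed hX hinv hT hindep hfinite l0 (ltW s0) st (eP m hm)
      (heigP_L2 m hm) (heigV_L2 n hn) centredV).
  rewrite /kd /kappa; have [<-|mn] := eqVneq m n.
    by rewrite hnormalized// mulr1 mul1r.
  by rewrite biorth// mulr0 !mul0r.
have Gbounds t s : 0 < s -> s <= t ->
    eta_ t * (lambda m * EL s + 1) <= G t s /\
    G t s <= eta_ (t - s) * (lambda m * EL s + 1).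
  move=> s0 st.
  exact: (correlation_factor_bounds hT hfinite l0 (ltW s0) st).
have eta_gt0 t : 0 < eta_ t by exact: (inverse_laplace_gt0 hT).
have A0 s : 0 < lambda m * EL s + 1.
  by rewrite ltr_wpDl// mulr_ge0//; exact: mean_inverse_ge0.
have kd0 : 0 <= kd by rewrite mulr_ge0// invr_ge0 mulr_ge0// sqrtr_ge0.
split; first by move=> t s s0 st; split; [exact: rhoPE|exact: rhoVE].
split.
  move=> t s s0 st; have [lb ub] := Gbounds t s s0 st.
  rewrite rhoPE// rhoVE//; split.
  - by move=> c0; split; exact: ler_wpM2l.
  - by move=> c0; split; exact: ler_wnM2l.
  - by split; exact: ler_wpM2l.
split.
  move=> s C s0 C0 supC.
  have [t0 [M [t00 st0 M1 etaM]]] := ratio_eventually_bounded eta_gt0 supC.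
  exists t0; split => //.
  - apply: (@asymp_bounded_sandwich _ eta_ (fun t => G t s) _ c _ s t0 M) => //.
    move=> t tt; have st : s <= t by exact: le_trans tt.
    have [lb ub] := Gbounds t s s0 st.
    by split => //; [exact: rhoPE|exact: etaM].
  - apply: (@asymp_bounded_sandwich _ eta_ (fun t => G t s) _ kd _ s t0 M) => //.
    move=> t tt; have st : s <= t by exact: le_trans tt.
    have [lb ub] := Gbounds t s s0 st.
    by split => //; [exact: rhoVE|exact: etaM].
move=> lt s s0; split.
- apply: (@asymp_equiv_sandwich _ eta_ (fun t => G t s) _ c _ s) => // t st.
  by have [lb ub] := Gbounds t s s0 st; split => //; exact: rhoPE.
- apply: (@asymp_equiv_sandwich _ eta_ (fun t => G t s) _ kd _ s) => // t st.
  by have [lb ub] := Gbounds t s s0 st; split => //; exact: rhoVE.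
Qed.
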